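(* The restriction $\Theta_{\mid\mathcal{H}_{\mathcal{SPP}}}:\mathcal{H}_{\mathcal{SPP}}\longrightarrow\mathbf{FQSym}$ is an isomorphism of Hopf algebras.
   Context: $\mathbb{K}$ is a commutative field. A double poset is a finite set with two partial orders $(P,\leq_1,\leq_2)$, considered up to isomorphism (bijections preserving and reflecting both orders); subsets are double posets by restriction. It is special if $\leq_2$ is total; if it has $n$ elements, $(P,\leq_2)$ is identified with $\{1,\ldots,n\}$. $\mathcal{H}_{\mathcal{SP}}$ is the $\mathbb{K}$-vector space with basis the isoclasses of special posets, graded by cardinality. It is a Hopf algebra. The product $PQ$ is the disjoint union of $P$ and $Q$, with $P,Q$ as double subposets, $x\leq_2 y$ for all $x\in P,y\in Q$, and no element of $P$ being $\leq_1$-comparable with an element of $Q$. The unit is the empty poset. The coproduct is $\Delta(P)=\sum_I (P\setminus I)\otimes I$, over subsets $I\subseteq P$ such that $x\in I$, $x\leq_1 y$ imply $y\in I$. A plane poset is a double poset $(P,\leq_h,\leq_r)$ such that two distinct elements are comparable for $\leq_h$ if and only if they are not comparable for $\leq_r$. Then $x\leq y$ iff ($x\leq_h y$ or $x\leq_r y$) is a total order, and $(P,\leq_h,\leq)$ is called a special plane poset. $\mathcal{H}_{\mathcal{SPP}}$ is the Hopf subalgebra of $\mathcal{H}_{\mathcal{SP}}$ spanned by special plane posets. $\mathbf{FQSym}$ is the Hopf algebra with basis $\bigsqcup_{n\geq0}\mathfrak{S}_n$ (permutations written as words $\sigma(1)\ldots\sigma(n)$). The product of $\sigma\in\mathfrak{S}_k$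 and $\tau\in\mathfrak{S}_l$ is the sum of all shuffles of the word $\sigma$ with the word $\tau$ shifted by $k$. The coproduct is $\Delta(\sigma)=\sum_{k=0}^n\sigma_1^{(k)}\otimes\sigma_2^{(k)}$, where $\sigma_1^{(k)},\sigma_2^{(k)}$ are the standardizations of $\sigma(1)\ldots\sigma(k)$ and $\sigma(k+1)\ldots\sigma(n)$. $\Theta:\mathcal{H}_{\mathcal{SP}}\to\mathbf{FQSym}$ is the Hopf algebra morphism $\Theta(P)=\sum_{\sigma\in S_P}\sigma$, where $S_P$ is the set of linear extensions of $P$: the $\sigma\in\mathfrak{S}_n$ such that $i<_1 j$ implies $\sigma^{-1}(i)<\sigma^{-1}(j)$. *)

(* Defs.v *)
From HB Require Import structures.
From mathcomp Require Import all_boot all_order all_algebra all_fingroup.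
From mathcomp Require Import finmap.
From mathcomp.multinomials Require Import monalg.

Set Implicit Arguments.
Unset Strict Implicit.
Unset Printing Implicit Defensive.

Import GRing.Theory.
Local Open Scope ring_scope.

(* [{malg K[B]}] is the vector space with basis B, [<< b >>] being the basis   *)
(* vector of b; the tensor product of the spaces with bases B and C is realised *)
(* as the space with basis B * C, where [<< (b, c) >>] stands for b (x) c.      *)

Section LinearExtension.
Variables (K : fieldType) (B : choiceType) (V : lmodType K).
Implicit Type f : B -> V.

Definition lext f (x : {malg K[B]}) : V := \sum_(b <- msupp x) x@_b *: f b.

Lemma lextEw f (x : {malg K[B]}) (d : {fset B}) :
  (msupp x `<=` d)%fset -> lext f x = \sum_(b <- d) x@_b *: f b.
Proof.
move=> le; rewrite /lext (big_fset_incl _ le) // => b _.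
by move=> /mcoeff_outdom ->; rewrite scale0r.
Qed.

Fact lext_is_linear f : linear (lext f).
Proof.
move=> a x y; pose d := (msupp (a *: x + y) `|` msupp x `|` msupp y)%fset.
have le1 : (msupp (a *: x + y) `<=` d)%fset.
  by apply/fsubsetP => b; rewrite !in_fsetU => ->.
have le2 : (msupp x `<=` d)%fset.
  by apply/fsubsetP => b; rewrite !in_fsetU => ->; rewrite orbT.
have le3 : (msupp y `<=` d)%fset.
  by apply/fsubsetP => b; rewrite !in_fsetU => ->; rewrite orbT.
rewrite (lextEw _ le1) (lextEw _ le2) (lextEw _ le3) scaler_sumr -big_split /=.
by apply: eq_bigr => b _; rewrite mcoeffD mcoeffZ scalerDl scalerA.
Qed.

HB.instance Definition _ f :=
  GRing.isLinear.Build K {malg K[B]} V *:%R (lext f) (lext_is_linear f).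

Lemma lextU f b : lext f << b >> = f b.
Proof. by rewrite /lext msuppU oner_eq0 big_seq_fset1 mcoeffUU scale1r. Qed.

Lemma linear_malg_ext (f g : {linear {malg K[B]} -> V}) :
  (forall b, f << b >> = g << b >>) -> f =1 g.
Proof.
move=> e x; rewrite [x]monalgE !linear_sum; apply: eq_bigr => b _ /=.
have -> : << x@_b *g b >> = x@_b *: << b >> :> {malg K[B]}.
  by apply/malgP => c; rewrite mcoeffZ !mcoeffU mulrnAr mulr1.
by rewrite !linearZ /= e.
Qed.

End LinearExtension.

Section Tensor.
Variable K : fieldType.
Implicit Types B C D : choiceType.

Definition tens B C (x : {malg K[B]}) (y : {malg K[C]}) :
    {malg K[(B * C)%type]} :=
  \sum_(b <- msupp x) \sum_(c <- msupp y) << x@_b * y@_c *g (b, c) >>.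

(* The linear map f (x) g, for linear maps f and g. *)
Definition tmap B C B' C' (f : {malg K[B]} -> {malg K[B']})
    (g : {malg K[C]} -> {malg K[C']}) :
    {malg K[(B * C)%type]} -> {malg K[(B' * C')%type]} :=
  lext (fun p => tens (f << p.1 >>) (g << p.2 >>)).

HB.instance Definition _ B C B' C' (f : {malg K[B]} -> {malg K[B']})
  (g : {malg K[C]} -> {malg K[C']}) := GRing.Linear.on (tmap f g).

Definition tassoc B C D :
    {malg K[(B * C * D)%type]} -> {malg K[(B * (C * D))%type]} :=
  lext (fun p => << (p.1.1, (p.1.2, p.2)) >>).

HB.instance Definition _ B C D := GRing.Linear.on (@tassoc B C D).

(* a (x) b (x) c (x) d |-> a (x) c (x) b (x) d *)
Definition tswap B :
    {malg K[(B * B * (B * B))%type]} -> {malg K[(B * B * (B * B))%type]} :=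
  lext (fun p => << ((p.1.1, p.2.1), (p.1.2, p.2.2)) >>).

HB.instance Definition _ B := GRing.Linear.on (@tswap B).

Lemma tensU B C (b : B) (c : C) : tens << b >> << c >> = << (b, c) >>.
Proof.
by rewrite /tens !msuppU oner_eq0 !big_seq_fset1 !mcoeffUU mulr1.
Qed.

Lemma tmapU B C B' C' (f : {malg K[B]} -> {malg K[B']})
    (g : {malg K[C]} -> {malg K[C']}) (b : B) (c : C) :
  tmap f g << (b, c) >> = tens (f << b >>) (g << c >>).
Proof. exact: lextU. Qed.

Lemma tmapUU B C B' C' (f : {malg K[B]} -> {malg K[B']})
    (g : {malg K[C]} -> {malg K[C']}) b c b' c' :
  f << b >> = << b' >> -> g << c >> = << c' >> ->
  tmap f g << (b, c) >> = << (b', c') >>.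
Proof. by move=> fb gc; rewrite tmapU fb gc tensU. Qed.

End Tensor.

Section Hopf.
Variable K : fieldType.

Record hopf_data (B : choiceType) := HopfData {
  hmul : {linear {malg K[(B * B)%type]} -> {malg K[B]}};
  hone : {malg K[B]};
  hcop : {linear {malg K[B]} -> {malg K[(B * B)%type]}};
  hcounit : {linear {malg K[B]} -> K^o} }.

Record hopf_algebra (B : choiceType) (H : hopf_data B) : Prop := {
  hmulA : forall x : {malg K[(B * B * B)%type]},
    hmul H (tmap (hmul H) id x) = hmul H (tmap id (hmul H) (tassoc x));
  hmul1l : forall x, hmul H (tens (hone H) x) = x;
  hmul1r : forall x, hmul H (tens x (hone H)) = x;
  hcopA : forall x,
    tassoc (tmap (hcop H) id (hcop H x)) = tmap id (hcop H) (hcop H x);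
  hcounitl : forall x,
    lext (fun p => (hcounit H << p.1 >> : K) *: << p.2 >>) (hcop H x) = x;
  hcounitr : forall x,
    lext (fun p => (hcounit H << p.2 >> : K) *: << p.1 >>) (hcop H x) = x;
  hcop1 : hcop H (hone H) = tens (hone H) (hone H);
  hcopM : forall x : {malg K[(B * B)%type]},
    hcop H (hmul H x)
    = tmap (hmul H) (hmul H) (tswap (tmap (hcop H) (hcop H) x));
  hcounit1 : hcounit H (hone H) = 1;
  hcounitM : forall x y : {malg K[B]},
    hcounit H (hmul H (tens x y)) = (hcounit H x : K) * hcounit H y;
  hantipode : exists S : {linear {malg K[B]} -> {malg K[B]}}, forall x,
    hmul H (tmap S id (hcop H x)) = (hcounit H x : K) *: hone H /\
    hmul H (tmap id S (hcop H x)) = (hcounit H x : K) *: hone H }.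

Record hopf_morphism (B C : choiceType) (H : hopf_data B) (H' : hopf_data C)
    (f : {linear {malg K[B]} -> {malg K[C]}}) : Prop := {
  hmorphM : forall x, f (hmul H x) = hmul H' (tmap f f x);
  hmorph1 : f (hone H) = hone H';
  hmorph_cop : forall x, hcop H' (f x) = tmap f f (hcop H x);
  hmorph_counit : forall x, hcounit H' (f x) = hcounit H x }.

Definition hopf_isomorphism (B C : choiceType) (H : hopf_data B)
    (H' : hopf_data C) (f : {linear {malg K[B]} -> {malg K[C]}}) : Prop :=
  [/\ hopf_algebra H, hopf_algebra H', hopf_morphism H H' f & bijective f].

End Hopf.

Section PartialOrders.
Variable T : finType.

Definition is_porder (r : rel T) : bool :=
  [&& [forall x, r x x],
      [forall x, forall y, r x y && r y x ==> (x == y)] &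
      [forall x, forall y, forall z, r x y && r y z ==> r x z]].

Definition porder : Type :=
  {r : {ffun T * T -> bool} | is_porder (fun x y => r (x, y))}.

HB.instance Definition _ := Finite.on porder.

Definition rel_of (r : porder) : rel T := fun x y => val r (x, y).

Lemma is_porderP (r : rel T) :
  reflect [/\ reflexive r, antisymmetric r & transitive r] (is_porder r).
Proof.
apply: (iffP and3P) => [[/forallP r1 /forallP r2 /forallP r3]|[r1 r2 r3]]; split.
- exact: r1.
- by move=> x y; have /forallP/(_ y)/implyP h := r2 x; move/h/eqP.
- move=> y x z rxy ryz; have /forallP/(_ y)/forallP/(_ z)/implyP := r3 x.
  by apply; rewrite rxy.
- exact/forallP.
- apply/forallP => x; apply/forallP => y; apply/implyP => h.
  by apply/eqP/r2.
- apply/forallP => x; apply/forallP => y; apply/forallP => z.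
  by apply/implyP => /andP[]; apply: r3.
Qed.

Lemma rel_ofP (r : porder) :
  [/\ reflexive (rel_of r), antisymmetric (rel_of r) & transitive (rel_of r)].
Proof. exact/is_porderP/(valP r). Qed.

Fact mk_porder_subproof (r : rel T) : is_porder r ->
  is_porder (fun x y => [ffun p : T * T => r p.1 p.2] (x, y)).
Proof.
move/is_porderP => [r1 r2 r3]; apply/is_porderP; split.
- by move=> x; rewrite ffunE /=.
- by move=> x y; rewrite !ffunE /=; apply: r2.
- by move=> y x z; rewrite !ffunE /=; apply: r3.
Qed.

Definition mk_porder (r : rel T) (rP : is_porder r) : porder :=
  exist _ [ffun p => r p.1 p.2] (mk_porder_subproof rP).

Lemma mk_porderE (r : rel T) (rP : is_porder r) : rel_of (mk_porder rP) =2 r.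
Proof. by move=> x y; rewrite /rel_of /= ffunE. Qed.

End PartialOrders.

Coercion rel_of : porder >-> rel.

Section Monotone.
Variables (T U : finType).

Fact relpre_is_porder (f : U -> T) (r : porder T) :
  injective f -> is_porder (relpre f r).
Proof.
move=> fI; have [r1 r2 r3] := rel_ofP r; apply/is_porderP; split => /=.
- by move=> x /=.
- by move=> x y /= /r2/fI.
- by move=> y x z /=; apply: r3.
Qed.

Definition porder_pre (f : U -> T) (fI : injective f) (r : porder T) : porder U :=
  mk_porder (relpre_is_porder r fI).

(* Order on the disjoint union; if b, every element of T is moreover smaller   *)
(* than every element of U.                                                    *)
Definition sum_rel (b : bool) (r : rel T) (s : rel U) : rel (T + U) :=
  fun x y => match x, y with
    | inl x, inl y => r x y
    | inr x, inr y => s x y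
    | inl _, inr _ => b
    | inr _, inl _ => false
    end.

Fact sum_rel_is_porder b (r : porder T) (s : porder U) :
  is_porder (sum_rel b r s).
Proof.
have [r1 r2 r3] := rel_ofP r; have [s1 s2 s3] := rel_ofP s.
apply/is_porderP; split.
- by case=> x /=.
- case=> [x|x] [y|y] //=; rewrite ?andbF //.
  + by move=> /r2 ->.
  + by move=> /s2 ->.
- by case=> y [x|x] [z|z] //=; [apply: r3|apply: s3].
Qed.

Definition porder_sum b (r : porder T) (s : porder U) : porder (T + U)%type :=
  mk_porder (sum_rel_is_porder b r s).

End Monotone.

(* The pair of orders of a double poset with underlying set T. *)
Definition dposet (T : finType) : Type := (porder T * porder T)%type.

Definition special (T : finType) (P : dposet T) : Prop := total P.2.

Definition comparable_for (T : finType) (r : rel T) (x y : T) : bool :=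
  r x y || r y x.

Definition plane (T : finType) (P : dposet T) : bool :=
  [forall x, forall y, (x != y) ==>
     (comparable_for P.1 x y == ~~ comparable_for P.2 x y)].

Definition special_plane (T : finType) (P : dposet T) : bool :=
  [exists ler : porder T, plane (P.1, ler) &&
     [forall x, forall y, P.2 x y == P.1 x y || ler x y]].

Definition dposet_iso (T U : finType) (P : dposet T) (Q : dposet U) : Prop :=
  exists2 f : T -> U, bijective f &
    (forall x y, Q.1 (f x) (f y) = P.1 x y) /\
    (forall x y, Q.2 (f x) (f y) = P.2 x y).

Definition dposet_mul (T U : finType) (P : dposet T) (Q : dposet U) :
    dposet (T + U)%type :=
  (porder_sum false P.1 Q.1, porder_sum true P.2 Q.2).

Definition dposet_sub (T : finType) (P : dposet T) (A : {set T}) :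
    dposet {x : T | x \in A} :=
  (porder_pre val_inj P.1, porder_pre val_inj P.2).

Definition upper_set (T : finType) (r : rel T) (I : {set T}) : bool :=
  [forall x in I, forall y, r x y ==> (y \in I)].

(* A special poset with n elements has a unique isomorphic copy on 'I_n whose   *)
(* second order is the natural one (see [isoclassP] and [isoclassK] below), so  *)
(* an isoclass is encoded by n and the first order of this copy.               *)
Definition sposet : Type := {n : nat & porder 'I_n}.

HB.instance Definition _ := Choice.copy sposet {n : nat & porder 'I_n}.

Fact nat_is_porder n : is_porder (fun i j : 'I_n => i <= j)%N.
Proof.
apply/is_porderP; split => [i|i j|j i k]; [exact: leqnn| |exact: leq_trans].
by rewrite -eqn_leq => /eqP/val_inj.
Qed.

Definition nat_porder n : porder 'I_n := mk_porder (@nat_is_porder n).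

Definition dposet_of (P : sposet) : dposet 'I_(tag P) :=
  (tagged P, nat_porder (tag P)).

Section Isoclass.
Variables (T : finType) (P : dposet T).

Definition sp_enum : #|T|.-tuple T := sort_tuple P.2 (enum_tuple T).

Fact sp_enum_inj : injective (tnth sp_enum).
Proof.
by apply/tuple_uniqP; rewrite /= sort_uniq enum_uniq.
Qed.

Definition isoclass : sposet :=
  Tagged (fun n => porder 'I_n) (porder_pre sp_enum_inj P.1).

End Isoclass.

Lemma porder_ext (T : finType) (r s : porder T) : r =2 s -> r = s.
Proof. by move=> e; apply: val_inj; apply/ffunP => -[x y]; apply: e. Qed.

Lemma dposet_iso_sym (T U : finType) (P : dposet T) (Q : dposet U) :
  dposet_iso P Q -> dposet_iso Q P.
Proof.
case=> f [g fK gK] [f1 f2]; exists g; first by exists f.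
by split=> x y; rewrite -?f1 -?f2 !gK.
Qed.

Lemma dposet_iso_trans (T U V : finType) (P : dposet T) (Q : dposet U)
    (R : dposet V) : dposet_iso P Q -> dposet_iso Q R -> dposet_iso P R.
Proof.
case=> f fb [f1 f2] [g gb [g1 g2]]; exists (g \o f); first exact: bij_comp.
by split=> x y /=; rewrite ?g1 ?g2.
Qed.

Lemma isoclass_iso (T : finType) (P : dposet T) :
  special P -> dposet_iso P (dposet_of (isoclass P)).
Proof.
move=> sP; apply: dposet_iso_sym; have [r1 r2 r3] := rel_ofP P.2.
exists (tnth (sp_enum P)).
  by apply: inj_card_bij; [exact: sp_enum_inj | rewrite card_ord].
split=> i j; first by rewrite /= mk_porderE.
rewrite mk_porderE.
have h (i' j' : 'I_#|T|) : (i' <= j')%N ->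
    P.2 (tnth (sp_enum P) i') (tnth (sp_enum P) j').
  move=> le; have x0 : T := tnth (sp_enum P) i'; rewrite !(tnth_nth x0).
  apply: (sorted_leq_nth r3 r1) => //; rewrite ?inE ?size_tuple ?ltn_ord //.
  exact: sort_sorted.
apply/idP/idP => [le|]; last exact: h.
rewrite leqNgt; apply/negP => lt; have le' := h _ _ (ltnW lt).
have/sp_enum_inj e : tnth (sp_enum P) i = tnth (sp_enum P) j.
  by apply: r2; rewrite le.
by rewrite e ltnn in lt.
Qed.

Lemma sposet_iso_eq (P Q : sposet) :
  dposet_iso (dposet_of P) (dposet_of Q) -> P = Q.
Proof.
case: P Q => [n r] [m s] [f fb [f1 f2]] /=.
have e : n = m by have := bij_eq_card fb; rewrite !card_ord.
case: m / e s f fb f1 f2 => s f fb f1 f2.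
have fE i : f i = i.
  apply: val_inj => /=.
  have fmono : {mono f : i j / (i <= j)%N}.
    by move=> i' j'; have := f2 i' j'; rewrite /= !mk_porderE.
  have cardle (k : 'I_n) : #|[set j : 'I_n | j < k]%N| = k.
    have le : (k <= n)%N by exact: ltnW.
    have wI : injective (widen_ord le) by move=> a b [/val_inj].
    rewrite -[RHS]card_ord -[RHS](card_imset _ wI).
    apply: eq_card => j; rewrite !inE; apply/idP/imsetP => [lt|[l _ ->]].
      by exists (Ordinal lt) => //; apply: val_inj.
    by rewrite /= ltn_ord.
  rewrite -[LHS]cardle -[RHS]cardle -[RHS](card_imset _ (bij_inj fb)).
  apply: eq_card => j; have [g fK gK] := fb.
  rewrite -[j]gK inE (mem_imset _ _ (bij_inj fb)) inE.
  by rewrite !ltnNge fmono.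
by congr Tagged; apply: porder_ext => i j; rewrite -[LHS]f1 /= !fE.
Qed.

Lemma special_dposet_of (P : sposet) : special (dposet_of P).
Proof. by move=> i j; rewrite !mk_porderE leq_total. Qed.

Lemma isoclassK (P : sposet) : isoclass (dposet_of P) = P.
Proof.
apply: sposet_iso_eq; apply: dposet_iso_sym; apply: isoclass_iso.
exact: special_dposet_of.
Qed.

Lemma isoclassP (T U : finType) (P : dposet T) (Q : dposet U) :
  special P -> special Q -> isoclass P = isoclass Q <-> dposet_iso P Q.
Proof.
move=> /isoclass_iso iP /isoclass_iso iQ; split=> [e|iPQ].
  by rewrite e in iP; apply: dposet_iso_trans iP (dposet_iso_sym iQ).
apply: sposet_iso_eq; apply: dposet_iso_trans (dposet_iso_sym iP) _.
exact: dposet_iso_trans iPQ iQ.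
Qed.

Definition sp_one : sposet := Tagged (fun n => porder 'I_n) (nat_porder 0).

Definition sp_mul (P Q : sposet) : sposet :=
  isoclass (dposet_mul (dposet_of P) (dposet_of Q)).

Definition sp_sub (P : sposet) (A : {set 'I_(tag P)}) : sposet :=
  isoclass (dposet_sub (dposet_of P) A).

Arguments sp_sub : clear implicits.

Lemma special_planeP (T : finType) (P : dposet T) :
  reflect (exists2 ler : porder T, plane (P.1, ler) &
             forall x y, P.2 x y = P.1 x y || ler x y) (special_plane P).
Proof.
apply: (iffP existsP) => -[r].
  by case/andP=> pl /'forall_forallP tot; exists r => // x y; exact/eqP/tot.
move=> pl tot; exists r; rewrite pl; apply/'forall_forallP => x y.
exact/eqP.
Qed.

Lemma planeP (T : finType) (P : dposet T) :
  reflect (forall x y, x != y ->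
             comparable_for P.1 x y = ~~ comparable_for P.2 x y) (plane P).
Proof.
apply: (iffP 'forall_forallP) => h x y.
  by move=> ne; have /implyP/(_ ne)/eqP := h x y.
by apply/implyP => ne; apply/eqP/h.
Qed.

Lemma special_plane_iso (T U : finType) (P : dposet T) (Q : dposet U) :
  dposet_iso P Q -> special_plane P -> special_plane Q.
Proof.
case=> f [g fK gK] [f1 f2] /special_planeP[r /planeP pl tot].
apply/special_planeP; exists (porder_pre (can_inj gK) r).
  apply/planeP => x y ne; rewrite /comparable_for /= !mk_porderE /=.
  rewrite -[x]gK -[y]gK !f1 !fK; apply: pl.
  by apply: contra_neq ne => /(can_inj gK).
by move=> x y; rewrite mk_porderE /=; have := tot (g x) (g y); rewrite -f1 -f2 !gK.
Qed.

Lemma special_plane_special (T : finType) (P : dposet T) :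
  special_plane P -> special P.
Proof.
case/special_planeP => r /planeP pl tot x y; have [r1 _ _] := rel_ofP P.2.
have [->|ne] := eqVneq x y; first by rewrite r1.
rewrite !tot; have := pl x y ne; rewrite /comparable_for /=.
by do 4!case: (rel_of _ _ _).
Qed.

Lemma special_plane_mul (T U : finType) (P : dposet T) (Q : dposet U) :
  special_plane P -> special_plane Q -> special_plane (dposet_mul P Q).
Proof.
case/special_planeP=> r /planeP plr totr /special_planeP[s /planeP pls tots].
apply/special_planeP; exists (porder_sum true r s).
  apply/planeP; rewrite /comparable_for /= => -[x|x] [y|y] ne;
    rewrite !mk_porderE //=.
  - by apply: plr; apply: contra_neq ne => ->.
  - by apply: pls; apply: contra_neq ne => ->.
by case=> x [] y; rewrite !mk_porderE /=.
Qed.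

Lemma special_plane_sub (T : finType) (P : dposet T) (A : {set T}) :
  special_plane P -> special_plane (dposet_sub P A).
Proof.
case/special_planeP=> r /planeP plr totr.
apply/special_planeP; exists (porder_pre val_inj r).
  apply/planeP => x y ne; rewrite /comparable_for /= !mk_porderE /=.
  by apply: plr; rewrite (inj_eq val_inj).
by move=> x y; rewrite !mk_porderE /=.
Qed.

Lemma special_plane_isoclass (T : finType) (P : dposet T) :
  special_plane P -> special_plane (dposet_of (isoclass P)).
Proof.
move=> sP; apply: special_plane_iso (sP).
exact/isoclass_iso/special_plane_special.
Qed.

Definition spposet : Type := {P : sposet | special_plane (dposet_of P)}.

HB.instance Definition _ := Choice.on spposet.

Fact spp_one_subproof : special_plane (dposet_of sp_one).
Proof.
by apply/special_planeP; exists (nat_porder 0); [apply/planeP => -[]|case].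
Qed.

Definition spp_one : spposet := exist _ sp_one spp_one_subproof.

Definition spp_mul (P Q : spposet) : spposet :=
  exist _ (sp_mul (val P) (val Q))
    (special_plane_isoclass (special_plane_mul (valP P) (valP Q))).

Definition spp_sub (P : spposet) (A : {set 'I_(tag (val P))}) : spposet :=
  exist _ (sp_sub (val P) A)
    (special_plane_isoclass (special_plane_sub A (valP P))).

Arguments spp_sub : clear implicits.

Section PosetHopf.
Variable K : fieldType.

(* The counit is the projection on degree 0. *)
Definition HSP : hopf_data K sposet := {|
  hmul := lext (fun p : sposet * sposet => << sp_mul p.1 p.2 >>);
  hone := << sp_one >>;
  hcop := lext (fun P : sposet =>
    \sum_(I : {set 'I_(tag P)} | upper_set (tagged P) I)
       << (sp_sub P (~: I), sp_sub P I) >>);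
  hcounit := lext (fun P : sposet => (P == sp_one)%:R : K^o) |}.

Definition HSPP : hopf_data K spposet := {|
  hmul := lext (fun p : spposet * spposet => << spp_mul p.1 p.2 >>);
  hone := << spp_one >>;
  hcop := lext (fun P : spposet =>
    \sum_(I : {set 'I_(tag (val P))} | upper_set (tagged (val P)) I)
       << (spp_sub P (~: I), spp_sub P I) >>);
  hcounit := lext (fun P : spposet => (P == spp_one)%:R : K^o) |}.

(* H_SPP is realised on the space spanned by the special plane posets alone.   *)
(* The lemmas below identify it, through HSPP_incl, with a Hopf subalgebra of   *)
(* H_SP.                                                                       *)
Definition HSPP_incl : {malg K[spposet]} -> {malg K[sposet]} :=
  lext (fun P : spposet => << val P >>).

HB.instance Definition _ := GRing.Linear.on HSPP_incl.

Lemma HSPP_inclU P : HSPP_incl << P >> = << val P >>.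
Proof. exact: lextU. Qed.

Lemma HSPP_incl_inj : injective HSPP_incl.
Proof.
move=> x y e; apply/malgP => P.
pose p : {linear {malg K[sposet]} -> K^o} := lext (fun Q => (Q == val P)%:R).
pose q : {linear {malg K[spposet]} -> K^o} := lext (fun Q => (Q == P)%:R).
have qE : p \o HSPP_incl =1 q.
  apply: (@linear_malg_ext _ _ _ (p \o HSPP_incl) q) => Q.
  by rewrite [LHS]/= HSPP_inclU /p /q /= !lextU (inj_eq val_inj).
have coefE z : q z = z@_P.
  rewrite [in RHS](monalgE z) raddf_sum /=; apply: eq_bigr => Q _.
  by rewrite mcoeffU -[RHS]mulr_natr.
by rewrite -!coefE -!qE /= e.
Qed.

Lemma HSPP_incl_morphism : hopf_morphism HSPP HSP HSPP_incl.
Proof.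
split.
- apply: (@linear_malg_ext _ _ _ (HSPP_incl \o hmul HSPP)
            (hmul HSP \o tmap HSPP_incl HSPP_incl)) => -[P Q].
  transitivity (HSPP_incl << spp_mul P Q >>).
    by apply: (congr1 HSPP_incl); exact: lextU.
  transitivity (hmul HSP << (val P, val Q) >>); last first.
    apply: (congr1 (hmul HSP)); apply: esym.
    exact: (tmapUU (HSPP_inclU P) (HSPP_inclU Q)).
  by rewrite HSPP_inclU; symmetry; exact: lextU.
- exact: HSPP_inclU.
- apply: (@linear_malg_ext _ _ _ (hcop HSP \o HSPP_incl)
            (tmap HSPP_incl HSPP_incl \o hcop HSPP)) => P.
  transitivity (hcop HSP << val P >>).
    by apply: (congr1 (hcop HSP)); exact: HSPP_inclU.
  rewrite [LHS]lextU.
  transitivity (tmap HSPP_incl HSPP_incl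
    (\sum_(I : {set 'I_(tag (val P))} | upper_set (tagged (val P)) I)
       << (spp_sub P (~: I), spp_sub P I) >>)); last first.
    by apply: (congr1 (tmap HSPP_incl HSPP_incl)); symmetry; exact: lextU.
  rewrite linear_sum; apply: eq_bigr => I _; apply: esym.
  exact: (tmapUU (HSPP_inclU (spp_sub P (~: I))) (HSPP_inclU (spp_sub P I))).
- apply: (@linear_malg_ext _ _ _ (hcounit HSP \o HSPP_incl)
            (hcounit HSPP)) => P.
  transitivity (hcounit HSP << val P >>).
    by apply: (congr1 (hcounit HSP)); exact: HSPP_inclU.
  by rewrite [LHS]lextU [RHS]lextU.
Qed.

End PosetHopf.

Arguments HSPP_incl : clear implicits.

(* Permutations act on {0, ..., n - 1}, so the letters of words start at 0. *)
Definition perms : Type := {n : nat & 'S_n}.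

HB.instance Definition _ := Choice.copy perms {n : nat & 'S_n}.

Definition mkperms n (s : 'S_n) : perms := Tagged (fun n => 'S_n) s.

Definition word n (s : 'S_n) : seq nat := [seq val (s i) | i <- enum 'I_n].

Definition is_shuffle (u v w : seq nat) : bool :=
  [exists m : (size w).-tuple bool,
     (mask m w == u) && (mask (map negb m) w == v)].

(* The default value is never used on words without repetition, see std_permP. *)
Definition std_perm (w : seq nat) : 'S_(size w) :=
  odflt 1%g [pick s : 'S_(size w) |
    [forall i, forall j, (s i < s j) == (nth 0 w i < nth 0 w j)]]%N.

Definition standardization (w : seq nat) : perms := mkperms (std_perm w).

Lemma std_permP (w : seq nat) : uniq w -> forall i j,
  (std_perm w i < std_perm w j)%N = (nth 0 w i < nth 0 w j)%N.
Proof.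
move=> uw; rewrite /std_perm; case: pickP => [s /'forall_forallP h i j|none].
  by rewrite /= (eqP (h i j)).
pose A (i : 'I_(size w)) := [set k : 'I_(size w) | (nth 0 w k < nth 0 w i)%N].
have Alt i : (#|A i| < size w)%N.
  rewrite -[X in (_ < X)%N]card_ord -cardsT; apply: proper_card.
  by apply/properP; split=> //; exists i; rewrite ?inE ?ltnn.
have Amono i j : (#|A i| < #|A j|)%N = (nth 0 w i < nth 0 w j)%N.
  have [lt|le] := ltnP (nth 0 w i) (nth 0 w j); last first.
    rewrite ltnNge subset_leq_card //; apply/subsetP => k; rewrite !inE => lt.
    exact: leq_trans lt le.
  apply: proper_card; apply/properP; split; last by exists i; rewrite !inE ?ltnn.
  by apply/subsetP => k; rewrite !inE => /ltn_trans; apply.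
have fI : injective (fun i => Ordinal (Alt i)).
  move=> i j /(congr1 val) /= e; apply: val_inj => /=; apply/eqP.
  rewrite -(nth_uniq 0 (ltn_ord i) (ltn_ord j) uw) eqn_leq.
  by rewrite leqNgt -Amono e ltnn /= leqNgt -Amono e ltnn.
have /negP[] := none (perm fI); apply/'forall_forallP => i j.
by rewrite !permE /= Amono.
Qed.

Section FQSym.
Variable K : fieldType.

(* The letters of the two shuffled words are pairwise distinct, so that each   *)
(* shuffle has coefficient 1.                                                  *)
Definition FQSym : hopf_data K perms := {|
  hmul := lext (fun p : perms * perms =>
    \sum_(r : 'S_(tag p.1 + tag p.2) |
        is_shuffle (word (tagged p.1)) (map (addn (tag p.1)) (word (tagged p.2)))
          (word r))
       << mkperms r >>);
  hone := << mkperms (1%g : 'S_0) >>;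
  hcop := lext (fun s : perms =>
    \sum_(k < (tag s).+1)
       << (standardization (take k (word (tagged s))),
           standardization (drop k (word (tagged s)))) >>);
  hcounit := lext (fun s : perms => (tag s == 0%N)%:R : K^o) |}.

Definition linear_extension n (r : porder 'I_n) (s : 'S_n) : bool :=
  [forall i, forall j, (i != j) && r i j ==> ((s^-1)%g i < (s^-1)%g j)%N].

Definition Theta : {malg K[sposet]} -> {malg K[perms]} :=
  lext (fun P : sposet =>
    \sum_(s : 'S_(tag P) | linear_extension (tagged P) s) << mkperms s >>).

HB.instance Definition _ := GRing.Linear.on Theta.

Definition Theta_HSPP : {malg K[spposet]} -> {malg K[perms]} :=
  Theta \o HSPP_incl K.

HB.instance Definition _ := GRing.Linear.on Theta_HSPP.

End FQSym.

Arguments Theta : clear implicits.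
Arguments Theta_HSPP : clear implicits.

(* Main.v *)
From HB Require Import structures.
Require Import Defs.
From mathcomp Require Import all_boot all_algebra all_fingroup.
From mathcomp Require Import finmap zify.
From mathcomp.multinomials Require Import monalg.

(** Two facts carry the result: compatibility of [Theta] with the Hopf structures,
    and unitriangularity of its restriction to special plane posets.

    A linear extension of [P] is a word listing the elements of [P] in which no
    element comes before a smaller one. Such a word for a product [P Q] is a
    shuffle of one for [P] and one for [Q], because elements of [P] and [Q] are
    incomparable ([is_shuffle_parts], [linear_extension_mul]). Cutting such a
    word in two pieces amounts to choosing an upper set, which is formed by the
    letters of the second piece, and a linear extension of it and of its
    complement ([sum_cut_compat]). Hence [Theta] is a morphism of algebras
    and of coalgebras ([Theta_mul], [Theta_cop]).

    Special plane posets are the orders cut out by permutations: [i] is below [j]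
    when [i <= j] and [i] comes before [j] in the word of [s]
    ([plane_spposet_surj]). The linear extensions of this poset are the
    permutations [t] whose inversions are inversions of [s]; among them, [s] is
    the only one with as many inversions as [s]
    ([linear_extension_inversions]). So, in the bases of permutations, the map is
    the identity plus terms with fewer inversions, and such a map is invertible
    ([unitriK], [unitri_invK]).

    The Hopf algebra laws are then proved on whichever side they are easier, and
    transported along the isomorphism. Coassociativity and the counit laws are
    checked on words, where a coproduct is a sum over the places to cut
    ([FQSym_coalgebra]). Associativity, the units and the compatibility of the
    product with the coproduct are checked on posets, where a product of basis
    elements is a basis element and upper sets of a disjoint union are pairs of
    upper sets ([sp_sub_mul]). The antipode exists in any graded connected
    bialgebra, as the geometric series of the projection to the augmentation
    ideal ([antipode_exists]). *)

Set Implicit Arguments.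
Unset Strict Implicit.
Unset Printing Implicit Defensive.

Import GRing.Theory.
Local Open Scope ring_scope.

(** * Free modules and their tensor products *)

Section FreeModules.
Variable K : fieldType.
Implicit Types B C D : choiceType.

Lemma malgU_scale B (a : K) (b : B) : << a *g b >> = a *: << b >> :> {malg K[B]}.
Proof. by apply/malgP => c; rewrite mcoeffZ !mcoeffU mulrnAr mulr1. Qed.

Lemma malg_expand B (x : {malg K[B]}) : x = \sum_(b <- msupp x) x@_b *: << b >>.
Proof.
by rewrite {1}[x]monalgE; apply: eq_bigr => b _; rewrite malgU_scale.
Qed.

Lemma lext_id B (f : {malg K[B]} -> {malg K[B]}) :
  (forall b, f << b >> = << b >>) -> lext (fun b => f << b >>) =1 id.
Proof.
by move=> fE x; rewrite [RHS]malg_expand; apply: eq_bigr => b _; rewrite fE.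
Qed.

Lemma eq_lext B (V : lmodType K) (f g : B -> V) : f =1 g -> lext f =1 lext g.
Proof. by move=> e x; apply: eq_bigr => b _; rewrite e. Qed.

Lemma eq_lext_supp B (V : lmodType K) (f g : B -> V) (x : {malg K[B]}) :
  {in msupp x, f =1 g} -> lext f x = lext g x.
Proof. by move=> e; rewrite /lext !big_seq; apply: eq_bigr => b bx; rewrite e. Qed.

Lemma lext_comp B (V W : lmodType K) (f : B -> V) (g : {linear V -> W}) x :
  g (lext f x) = lext (g \o f) x.
Proof. by rewrite linear_sum; apply: eq_bigr => b _; rewrite linearZ. Qed.

Lemma lextD B (V : lmodType K) (f g : B -> V) x :
  lext (fun b => f b + g b) x = lext f x + lext g x.
Proof. by rewrite -big_split; apply: eq_bigr => b _; rewrite scalerDr. Qed.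

Lemma lext_sum B (V : lmodType K) (I : finType) (a : I -> K) (f : I -> B -> V) x :
  lext (fun b => \sum_i a i *: f i b) x = \sum_i a i *: lext (f i) x.
Proof.
under [RHS]eq_bigr do rewrite scaler_sumr.
rewrite [RHS]exchange_big; apply: eq_bigr => b _; rewrite scaler_sumr.
by apply: eq_bigr => i _; rewrite !scalerA mulrC.
Qed.

Lemma msupp_sum_basis B (I : finType) (P : pred I) (f : I -> B) b :
  b \in msupp (\sum_(i | P i) << f i >> : {malg K[B]}) ->
  exists2 i, P i & b = f i.
Proof.
move=> bS; have [/exists_inP[i Pi /eqP ->]|] := boolP [exists (i | P i), b == f i].
  by exists i.
rewrite negb_exists_in => /forall_inP none; move: bS.
rewrite -mcoeff_neq0 raddf_sum big1 ?eqxx // => i /none ne /=.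
by rewrite mcoeffU eq_sym (negbTE ne).
Qed.

Lemma tensE B C (x : {malg K[B]}) (y : {malg K[C]}) :
  tens x y = lext (fun b => lext (fun c => << (b, c) >>) y) x.
Proof.
apply: eq_bigr => b _; rewrite scaler_sumr; apply: eq_bigr => c _.
by rewrite malgU_scale scalerA.
Qed.

Fact tens_is_linear B C (x : {malg K[B]}) : linear (@tens K B C x).
Proof.
move=> a y z; rewrite !tensE !(eq_lext (fun b => linearP _ a y z)).
rewrite lextD; congr (_ + _).
by rewrite scaler_sumr; apply: eq_bigr => b _; rewrite !scalerA mulrC.
Qed.

HB.instance Definition _ B C (x : {malg K[B]}) :=
  GRing.isLinear.Build K {malg K[C]} {malg K[(B * C)%type]} *:%R (tens x)
    (@tens_is_linear B C x).

(** [tens] with its arguments exchanged, so that linearity in the first one can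
    be registered as an instance. *)
Definition tensl B C (y : {malg K[C]}) (x : {malg K[B]}) := tens x y.

Fact tensl_is_linear B C (y : {malg K[C]}) : linear (@tensl B C y).
Proof. by move=> a x z; rewrite /tensl !tensE linearP. Qed.

HB.instance Definition _ B C (y : {malg K[C]}) :=
  GRing.isLinear.Build K {malg K[B]} {malg K[(B * C)%type]} *:%R (tensl y)
    (@tensl_is_linear B C y).

Lemma tensZl B C a (x : {malg K[B]}) (y : {malg K[C]}) :
  tens (a *: x) y = a *: tens x y.
Proof. by rewrite -[LHS]/(tensl y _) linearZ. Qed.

Lemma tens_sum B C (I J : Type) (r : seq I) (s : seq J) (p : pred I) (q : pred J)
    (x : I -> {malg K[B]}) (y : J -> {malg K[C]}) :
  tens (\sum_(i <- r | p i) x i) (\sum_(j <- s | q j) y j) =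
  \sum_(i <- r | p i) \sum_(j <- s | q j) tens (x i) (y j).
Proof.
rewrite -[LHS]/(tensl _ _) (linear_sum (tensl _)); apply: eq_bigr => i _.
exact: (linear_sum (tens (x i))).
Qed.

Lemma tmap_tens B C B' C' (f : {linear {malg K[B]} -> {malg K[B']}})
    (g : {linear {malg K[C]} -> {malg K[C']}}) x y :
  tmap f g (tens x y) = tens (f x) (g y).
Proof.
pose l1 : {linear _ -> _} := tmap f g \o tens x.
pose r1 : {linear _ -> _} := tens (f x) \o g.
apply: (linear_malg_ext (f := l1) (g := r1)) => c /=.
pose l2 : {linear _ -> _} := tmap f g \o tensl << c >>.
pose r2 : {linear _ -> _} := tensl (g << c >>) \o f.
apply: (linear_malg_ext (f := l2) (g := r2)) => b /=.
by rewrite /tensl tensU tmapU.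
Qed.

Lemma eq_tmap B C B' C' (f f' : {malg K[B]} -> {malg K[B']})
    (g g' : {malg K[C]} -> {malg K[C']}) :
  f =1 f' -> g =1 g' -> tmap f g =1 tmap f' g'.
Proof. by move=> ef eg; apply: eq_lext => p; rewrite ef eg. Qed.

Lemma eq_tmap_supp B C B' C' (f f' : {malg K[B]} -> {malg K[B']})
    (g g' : {malg K[C]} -> {malg K[C']}) (x : {malg K[(B * C)%type]}) :
  {in msupp x, forall p, f << p.1 >> = f' << p.1 >>} ->
  {in msupp x, forall p, g << p.2 >> = g' << p.2 >>} ->
  tmap f g x = tmap f' g' x.
Proof. by move=> ef eg; apply: eq_lext_supp => p px; rewrite ef ?eg. Qed.

Lemma tmap_comp B C B' C' B'' C'' (f : {malg K[B]} -> {malg K[B']})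
    (g : {malg K[C]} -> {malg K[C']})
    (f' : {linear {malg K[B']} -> {malg K[B'']}})
    (g' : {linear {malg K[C']} -> {malg K[C'']}}) x :
  tmap f' g' (tmap f g x) = tmap (f' \o f) (g' \o g) x.
Proof. by rewrite /tmap lext_comp; apply: eq_lext => p /=; rewrite -tmap_tens. Qed.

Lemma tmap_compl B C B' C' B'' (f : {malg K[B]} -> {malg K[B']})
    (g : {malg K[C]} -> {malg K[C']})
    (f' : {linear {malg K[B']} -> {malg K[B'']}}) x :
  tmap f' id (tmap f g x) = tmap (f' \o f) g x.
Proof. exact: (tmap_comp f g f' idfun). Qed.

Lemma tmap_compr B C B' C' C'' (f : {malg K[B]} -> {malg K[B']})
    (g : {malg K[C]} -> {malg K[C']})
    (g' : {linear {malg K[C']} -> {malg K[C'']}}) x :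
  tmap id g' (tmap f g x) = tmap f (g' \o g) x.
Proof. exact: (tmap_comp f g idfun g'). Qed.

Lemma tmap_id B C : @tmap K B C B C id id =1 id.
Proof.
apply: (linear_malg_ext (g := idfun)) => -[b c].
by rewrite /= tmapU tensU.
Qed.

Lemma tmapK B C (f : {linear {malg K[B]} -> {malg K[C]}})
    (g : {linear {malg K[C]} -> {malg K[B]}}) :
  cancel f g -> cancel (tmap f f) (tmap g g).
Proof. by move=> fK x; rewrite tmap_comp (eq_tmap fK fK) tmap_id. Qed.

Lemma tassoc_tens B C D (x : {malg K[B]}) (y : {malg K[C]}) (z : {malg K[D]}) :
  tassoc (tens (tens x y) z) = tens x (tens y z).
Proof.
pose l1 : {linear {malg K[D]} -> _} := @tassoc K B C D \o tens (tens x y).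
pose r1 : {linear {malg K[D]} -> _} := tens x \o tens y.
suff: l1 =1 r1 by exact.
apply: linear_malg_ext => d /=.
pose l2 : {linear {malg K[C]} -> _} := @tassoc K B C D \o tensl << d >> \o tens x.
pose r2 : {linear {malg K[C]} -> _} := tens x \o tensl << d >>.
suff: l2 =1 r2 by exact.
apply: linear_malg_ext => c /=.
pose l3 : {linear {malg K[B]} -> _} := @tassoc K B C D \o tensl << d >> \o tensl << c >>.
pose r3 : {linear {malg K[B]} -> _} := tensl (tens << c >> << d >>).
suff: l3 =1 r3 by exact.
apply: linear_malg_ext => b /=.
by rewrite /tensl !tensU; exact: lextU.
Qed.

Lemma tswap_tens B (x y z t : {malg K[B]}) :
  tswap (tens (tens x y) (tens z t)) = tens (tens x z) (tens y t).
Proof.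
pose l1 : {linear {malg K[B]} -> _} := @tswap K B \o tens (tens x y) \o tens z.
pose r1 : {linear {malg K[B]} -> _} := tens (tens x z) \o tens y.
suff: l1 =1 r1 by exact.
apply: linear_malg_ext => d /=.
pose l2 : {linear {malg K[B]} -> _} := @tswap K B \o tens (tens x y) \o tensl << d >>.
pose r2 : {linear {malg K[B]} -> _} := tensl (tens y << d >>) \o tens x.
suff: l2 =1 r2 by exact.
apply: linear_malg_ext => c /=.
pose l3 : {linear {malg K[B]} -> _} :=
  @tswap K B \o tensl (tens << c >> << d >>) \o tens x.
pose r3 : {linear {malg K[B]} -> _} := tens (tens x << c >>) \o tensl << d >>.
suff: l3 =1 r3 by exact.
apply: linear_malg_ext => b /=.
pose l4 : {linear {malg K[B]} -> _} :=
  @tswap K B \o tensl (tens << c >> << d >>) \o tensl << b >>.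
pose r4 : {linear {malg K[B]} -> _} := tensl (tens << b >> << d >>) \o tensl << c >>.
suff: l4 =1 r4 by exact.
apply: linear_malg_ext => a /=.
by rewrite /tensl !tensU; exact: lextU.
Qed.

Lemma tassoc_tmap B C D B' C' D' (f : {linear {malg K[B]} -> {malg K[B']}})
    (g : {linear {malg K[C]} -> {malg K[C']}})
    (h : {linear {malg K[D]} -> {malg K[D']}}) x :
  tassoc (tmap (tmap f g) h x) = tmap f (tmap g h) (tassoc x).
Proof.
pose l : {linear _ -> _} := @tassoc K B' C' D' \o tmap (tmap f g) h.
pose r : {linear _ -> _} := tmap f (tmap g h) \o @tassoc K B C D.
apply: (linear_malg_ext (f := l) (g := r)) => -[[b c] d] /=.
by rewrite -!tensU !(tassoc_tens, tmap_tens) /= !(tassoc_tens, tmap_tens).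
Qed.

Lemma tswap_tmap B B' (f : {linear {malg K[B]} -> {malg K[B']}}) x :
  tswap (tmap (tmap f f) (tmap f f) x) = tmap (tmap f f) (tmap f f) (tswap x).
Proof.
pose l : {linear _ -> _} := @tswap K B' \o tmap (tmap f f) (tmap f f).
pose r : {linear _ -> _} := tmap (tmap f f) (tmap f f) \o @tswap K B.
apply: (linear_malg_ext (f := l) (g := r)) => -[[a b] [c d]] /=.
rewrite -!tensU.
rewrite [X in tswap X = _](tmap_tens (tmap f f) (tmap f f)) /=.
rewrite !(tmap_tens f f).
rewrite (tswap_tens (f _)).
rewrite (tswap_tens << a >>).
by rewrite (tmap_tens (tmap f f) (tmap f f)) /= !(tmap_tens f f).
Qed.

(** The maps [lext (fun p => e << p.1 >> *: << p.2 >>)] of the counit laws are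
    defined on basis vectors; on all pure tensors they evaluate the form [e] on
    one factor. *)
Lemma lext_evall B C (e : {linear {malg K[B]} -> K^o}) x (y : {malg K[C]}) :
  lext (fun p => (e << p.1 >> : K) *: << p.2 >>) (tens x y) = (e x : K) *: y.
Proof.
pose ev : {linear _ -> _} := lext (fun p : B * C => (e << p.1 >> : K) *: << p.2 >>).
have evU b : ev (tens << b >> y) = (e << b >> : K) *: y.
  pose l : {linear {malg K[C]} -> _} := ev \o tens << b >>.
  pose r : {linear {malg K[C]} -> _} := *:%R (e << b >> : K).
  suff: l =1 r by exact.
  by apply: linear_malg_ext => c /=; rewrite tensU /ev lextU.
rewrite -[LHS]/(ev _) -/(tensl y x) [x]malg_expand (linear_sum (tensl y)).
rewrite (linear_sum ev) (linear_sum e) scaler_suml.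
apply: eq_bigr => b _ /=; rewrite [tensl _ _]linearZ [ev _]linearZ [e _]linearZ.
by rewrite /tensl evU; exact: scalerA.
Qed.

Lemma lext_evalr B C (e : {linear {malg K[C]} -> K^o}) (x : {malg K[B]}) y :
  lext (fun p => (e << p.2 >> : K) *: << p.1 >>) (tens x y) = (e y : K) *: x.
Proof.
pose ev : {linear _ -> _} := lext (fun p : B * C => (e << p.2 >> : K) *: << p.1 >>).
have evU b : ev (tens x << b >>) = (e << b >> : K) *: x.
  pose l : {linear {malg K[B]} -> _} := ev \o tensl << b >>.
  pose r : {linear {malg K[B]} -> _} := *:%R (e << b >> : K).
  suff: l =1 r by exact.
  by apply: linear_malg_ext => c /=; rewrite /tensl tensU /ev lextU.
rewrite -[LHS]/(ev _) [y]malg_expand (linear_sum (tens x)).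
rewrite (linear_sum ev) (linear_sum e) scaler_suml.
apply: eq_bigr => b _ /=; rewrite [tens _ _]linearZ [ev _]linearZ [e _]linearZ.
by rewrite evU; exact: scalerA.
Qed.

End FreeModules.

Arguments tensl {K B C} y x.

(** * Unitriangular maps and transport of structure *)

Section Unitriangular.
Variables (K : fieldType) (B : choiceType) (mu : B -> nat).
Variable N : B -> {malg K[B]}.
Hypothesis N_lt : forall b, {in msupp (N b), forall c, (mu c < mu b)%N}.

(** The recursion [g b = b - g (N b)], unfolded [k] times: the result no longer
    depends on [k] once [k] exceeds the measure of [b]. *)
Fixpoint inv_upto k : B -> {malg K[B]} :=
  if k is k'.+1 then fun b => << b >> - lext (inv_upto k') (N b)
  else fun=> 0.

Lemma inv_upto_stable k l b :
  (mu b < k)%N -> (mu b < l)%N -> inv_upto k b = inv_upto l b.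
Proof.
elim: k l b => [//|k IHk] [//|l] b; rewrite !ltnS => bk bl /=.
congr (_ - _); apply: eq_lext_supp => c /N_lt cb.
by apply: IHk; apply: leq_trans cb _.
Qed.

Definition unitri_inv b := inv_upto (mu b).+1 b.

Lemma unitri_invE b : unitri_inv b = << b >> - lext unitri_inv (N b).
Proof.
congr (_ - _); apply: eq_lext_supp => c /N_lt cb.
exact: inv_upto_stable.
Qed.

(** An inverse [g] of [b |-> b + N b] has to satisfy [g b = b - g (N b)]; as [N]
    decreases the measure, this is a well-founded recursion that defines [g]. *)
Lemma unitriK : cancel (lext (fun b => << b >> + N b)) (lext unitri_inv).
Proof.
move=> x; rewrite lext_comp.
suff e : lext unitri_inv \o (fun b => << b >> + N b) =1 (fun b => << b >>).
  by rewrite (eq_lext e) (@lext_id _ _ idfun).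
by move=> b /=; rewrite linearD /= lextU unitri_invE subrK.
Qed.

Lemma unitri_invK : cancel (lext unitri_inv) (lext (fun b => << b >> + N b)).
Proof.
have UK b : lext (fun b => << b >> + N b) (unitri_inv b) = << b >>.
  have [k] := ubnP (mu b); elim: k b => // k IHk b; rewrite ltnS => bk.
  rewrite unitri_invE linearB /= lextU [X in _ - X]lext_comp.
  rewrite (@eq_lext_supp _ _ _ _ (fun b => << b >>)) => [|c /N_lt cb /=].
    by rewrite (@lext_id _ _ idfun) // addrK.
  by apply: IHk; apply: leq_trans cb _.
move=> x; rewrite lext_comp (eq_lext (g := fun b => << b >>)) //.
by rewrite (@lext_id _ _ idfun).
Qed.

End Unitriangular.

Section Transport.
Variables (K : fieldType) (B C : choiceType).
Variables (H : hopf_data K B) (H' : hopf_data K C).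

(** The part of [hopf_algebra] that speaks of the coproduct and the counit
    alone. It is separated because it is proved for permutations and carried over
    to special plane posets, whereas the other laws travel the other way. *)
Record coalgebra_laws (D : choiceType) (A : hopf_data K D) : Prop := {
  cop_assoc : forall x,
    tassoc (tmap (hcop A) id (hcop A x)) = tmap id (hcop A) (hcop A x);
  counit_left : forall x,
    lext (fun p => (hcounit A << p.1 >> : K) *: << p.2 >>) (hcop A x) = x;
  counit_right : forall x,
    lext (fun p => (hcounit A << p.2 >> : K) *: << p.1 >>) (hcop A x) = x }.

Lemma hopf_morphism_inv (f : {linear {malg K[B]} -> {malg K[C]}})
    (g : {linear {malg K[C]} -> {malg K[B]}}) :
  cancel f g -> cancel g f -> hopf_morphism H H' f -> hopf_morphism H' H g.
Proof.
move=> fK gK [fM f1 fcop fcou].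
have [tfK tgK] := (tmapK fK, tmapK gK).
split.
- by move=> x; apply: (can_inj fK); rewrite gK fM tgK.
- by rewrite -f1 fK.
- by move=> x; apply: (can_inj tfK); rewrite tgK -fcop gK.
- by move=> x; rewrite -fcou gK.
Qed.

Variable f : {linear {malg K[B]} -> {malg K[C]}}.
Variable g : {linear {malg K[C]} -> {malg K[B]}}.
Hypotheses (gK : cancel g f) (fm : hopf_morphism H H' f).

Let tgK : cancel (tmap g g) (tmap f f).
Proof. exact: tmapK. Qed.

Let cop_f : hcop H' \o f =1 tmap f f \o hcop H.
Proof. exact: hmorph_cop fm. Qed.

Let mul_f : hmul H' \o tmap f f =1 f \o hmul H.
Proof. by move=> x /=; rewrite (hmorphM fm). Qed.

(** Every element is [f (g x)], and [f] commutes with the structure maps, so each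
    law for [H'] is the image under [f] of the same law for [H]. *)
Lemma coalgebra_transport : coalgebra_laws H -> coalgebra_laws H'.
Proof.
case=> copA cl cr; split=> x; rewrite -[x]gK; move: (g x) => {}x.
- rewrite (hmorph_cop fm) tmap_compl tmap_compr.
  rewrite (eq_tmap cop_f (fun=> erefl)) (eq_tmap (fun=> erefl) cop_f).
  rewrite -[tmap (tmap f f \o _) f _](tmap_comp _ id) tassoc_tmap copA.
  exact: (tmap_comp id).
- rewrite (hmorph_cop fm) -[in RHS](cl x).
  move: (hcop H x); pose l : {linear _ -> _} :=
    lext (fun p : C * C => (hcounit H' << p.1 >> : K) *: << p.2 >>) \o tmap f f.
  pose r : {linear _ -> _} :=
    f \o lext (fun p : B * B => (hcounit H << p.1 >> : K) *: << p.2 >>).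
  suff: l =1 r by exact.
  apply: linear_malg_ext => -[b c] /=; rewrite tmapU lext_evall lextU linearZ.
  by rewrite (hmorph_counit fm).
- rewrite (hmorph_cop fm) -[in RHS](cr x).
  move: (hcop H x); pose l : {linear _ -> _} :=
    lext (fun p : C * C => (hcounit H' << p.2 >> : K) *: << p.1 >>) \o tmap f f.
  pose r : {linear _ -> _} :=
    f \o lext (fun p : B * B => (hcounit H << p.2 >> : K) *: << p.1 >>).
  suff: l =1 r by exact.
  apply: linear_malg_ext => -[b c] /=; rewrite tmapU lext_evalr lextU linearZ.
  by rewrite (hmorph_counit fm).
Qed.

Lemma hopf_transport :
  cancel f g -> hopf_algebra H -> hopf_algebra H'.
Proof.
move=> fK [mA m1l m1r cA cl cr c1 cM e1 eM [S SP]].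
have [f1 [cA' cl' cr']] := (hmorph1 fm, coalgebra_transport (Build_coalgebra_laws cA cl cr)).
split=> //.
- move=> x; have -> : x = tmap (tmap f f) f (tmap (tmap g g) g x).
    by rewrite tmap_comp (eq_tmap tgK gK) tmap_id.
  move: (tmap _ g x) => {}x.
  rewrite tassoc_tmap tmap_compl tmap_compr.
  rewrite (eq_tmap mul_f (fun=> erefl)) (eq_tmap (fun=> erefl) mul_f).
  rewrite -[tmap (f \o _) f _](tmap_comp _ id) -(hmorphM fm) mA (hmorphM fm).
  by rewrite (tmap_comp id).
- by move=> x; rewrite -[x]gK -f1 -tmap_tens -(hmorphM fm) m1l.
- by move=> x; rewrite -[x]gK -f1 -tmap_tens -(hmorphM fm) m1r.
- by rewrite -f1 (hmorph_cop fm) c1 tmap_tens.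
- move=> x; rewrite -[x]tgK; move: (tmap g g x) => {}x.
  rewrite -(hmorphM fm) (hmorph_cop fm) cM.
  rewrite [X in _ = tmap _ _ (tswap X)]tmap_comp (eq_tmap cop_f cop_f).
  rewrite -[tmap (tmap f f \o _) _ _]tmap_comp tswap_tmap.
  by rewrite !tmap_comp (eq_tmap mul_f mul_f).
- by rewrite -f1 (hmorph_counit fm).
- move=> x y; rewrite -[x]gK -[y]gK -tmap_tens -(hmorphM fm).
  by rewrite !(hmorph_counit fm).
- exists (f \o S \o g) => x; rewrite -[x]gK; move: (g x) => {}x.
  have fSg : (f \o S \o g) \o f =1 f \o S by move=> y /=; rewrite fK.
  rewrite (hmorph_cop fm) tmap_compl tmap_compr (hmorph_counit fm) -f1.
  rewrite (eq_tmap fSg (fun=> erefl)) (eq_tmap (fun=> erefl) fSg).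
  have [Sl Sr] := SP x; split.
    by rewrite -[tmap _ _ _](tmap_comp _ id) -(hmorphM fm) Sl linearZ.
  by rewrite -[tmap _ _ _](tmap_comp id) -(hmorphM fm) Sr linearZ.
Qed.

End Transport.

(** * The antipode of a graded connected bialgebra *)

Section Antipode.
Variables (K : fieldType) (B : choiceType) (H : hopf_data K B).
Variables (deg : B -> nat) (b1 : B).
Implicit Types f g h : {linear {malg K[B]} -> {malg K[B]}}.

Hypothesis mulA : forall x : {malg K[(B * B * B)%type]},
  hmul H (tmap (hmul H) id x) = hmul H (tmap id (hmul H) (tassoc x)).
Hypothesis mul1l : forall x, hmul H (tens (hone H) x) = x.
Hypothesis mul1r : forall x, hmul H (tens x (hone H)) = x.
Hypothesis coalgH : coalgebra_laws H.
Hypothesis oneE : hone H = << b1 >>.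
Hypothesis counitE : forall b, hcounit H << b >> = (deg b == 0)%:R.
Hypothesis deg_eq0 : forall b, (deg b == 0) = (b == b1).
Hypothesis cop_deg : forall b,
  {in msupp (hcop H << b >>), forall p, (deg p.1 + deg p.2)%N = deg b}.

Definition conv (f g : {malg K[B]} -> {malg K[B]}) : {malg K[B]} -> {malg K[B]} :=
  hmul H \o tmap f g \o hcop H.

HB.instance Definition _ f g := GRing.Linear.on (conv f g).

Lemma eq_conv (f f' g g' : {malg K[B]} -> {malg K[B]}) :
  f =1 f' -> g =1 g' -> conv f g =1 conv f' g'.
Proof. by move=> ef eg x; rewrite /conv /= (eq_tmap ef eg). Qed.

Lemma conv_assoc f g h : conv (conv f g) h =1 conv f (conv g h).
Proof.
move=> x; have e1 : tmap (conv f g) h (hcop H x) =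
    tmap (hmul H) id (tmap (tmap f g) h (tmap (hcop H) id (hcop H x))).
  by rewrite tmap_compl (tmap_comp _ id).
have e2 : tmap f (conv g h) (hcop H x) =
    tmap id (hmul H) (tmap f (tmap g h) (tmap id (hcop H) (hcop H x))).
  by rewrite tmap_compr (tmap_comp id).
by rewrite /conv /= e1 e2 mulA tassoc_tmap (cop_assoc coalgH).
Qed.

Definition conv_unit (x : {malg K[B]}) : {malg K[B]} :=
  (hcounit H x : K) *: hone H.

Fact conv_unit_is_linear : linear conv_unit.
Proof.
move=> a x y; rewrite /conv_unit (linearP (hcounit H)) scalerDl.
have -> // : ((a *: hcounit H x : K^o) : K) *: hone H =
  a *: ((hcounit H x : K) *: hone H) by rewrite scalerA.
Qed.

HB.instance Definition _ := GRing.isLinear.Build K {malg K[B]} {malg K[B]}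
  *:%R conv_unit conv_unit_is_linear.

Lemma conv1l f : conv conv_unit f =1 f.
Proof.
move=> x; rewrite -[in RHS](counit_left coalgH x) /conv /=.
move: (hcop H x); pose l : {linear {malg K[(B * B)%type]} -> _} :=
  hmul H \o tmap conv_unit f.
pose r : {linear {malg K[(B * B)%type]} -> _} :=
  f \o lext (fun p : B * B => (hcounit H << p.1 >> : K) *: << p.2 >>).
suff: l =1 r by exact.
apply: linear_malg_ext => -[b c] /=.
by rewrite tmapU tensZl linearZ mul1l lextU linearZ.
Qed.

Lemma conv1r f : conv f conv_unit =1 f.
Proof.
move=> x; rewrite -[in RHS](counit_right coalgH x) /conv /=.
move: (hcop H x); pose l : {linear {malg K[(B * B)%type]} -> _} :=
  hmul H \o tmap f conv_unit.
pose r : {linear {malg K[(B * B)%type]} -> _} :=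
  f \o lext (fun p : B * B => (hcounit H << p.2 >> : K) *: << p.1 >>).
suff: l =1 r by exact.
apply: linear_malg_ext => -[b c] /=.
by rewrite tmapU /conv_unit 2!linearZ mul1r lextU linearZ.
Qed.

(** The projection onto the augmentation ideal, along the line of the unit. *)
Definition aug (x : {malg K[B]}) : {malg K[B]} := x - conv_unit x.

Fact aug_is_linear : linear aug.
Proof. by move=> a x y; rewrite /aug (linearP conv_unit) scalerBr opprD addrACA. Qed.

HB.instance Definition _ := GRing.isLinear.Build K {malg K[B]} {malg K[B]}
  *:%R aug aug_is_linear.

Fixpoint aug_pow k : {linear {malg K[B]} -> {malg K[B]}} :=
  if k is k'.+1 then conv aug (aug_pow k') else conv_unit.

Lemma aug_pow_comm k : conv (aug_pow k) aug =1 conv aug (aug_pow k).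
Proof.
elim: k => [|k IHk] x /=; first by rewrite conv1l conv1r.
by rewrite conv_assoc; apply: eq_conv.
Qed.

Lemma augU b : aug << b >> = if deg b == 0 then 0 else << b >>.
Proof.
rewrite /aug /conv_unit counitE oneE; case: eqP => [/eqP|_].
  by rewrite deg_eq0 => /eqP ->; rewrite scale1r subrr.
by rewrite scale0r subr0.
Qed.

(** A term of the [k]-fold coproduct of [b] survives under [aug] in all its [k]
    factors only if each of them has positive degree; their degrees add up to
    [deg b]. *)
Lemma aug_pow_eq0 k b : (deg b < k)%N -> aug_pow k << b >> = 0.
Proof.
elim: k b => // k IHk b bk; rewrite /= /conv /= /tmap.
rewrite (@eq_lext_supp _ _ _ _ (fun=> 0)) => [|p /cop_deg pb].
  by rewrite /lext big1 ?linear0 // => p _; rewrite scaler0.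
rewrite augU; case: eqP => [_|/eqP p0]; first by rewrite -/(tensl _ _) linear0.
by rewrite IHk ?linear0 //; move: p0 pb bk; lia.
Qed.

Definition antip_upto N (x : {malg K[B]}) : {malg K[B]} :=
  \sum_(k < N.+1) (-1) ^+ k *: aug_pow k x.

Fact antip_upto_is_linear N : linear (antip_upto N).
Proof.
move=> a x y; rewrite /antip_upto scaler_sumr -big_split /=.
apply: eq_bigr => k _; rewrite (linearP (aug_pow k)) scalerDr !scalerA.
by rewrite [a * _]mulrC.
Qed.

HB.instance Definition _ N := GRing.isLinear.Build K {malg K[B]} {malg K[B]}
  *:%R (antip_upto N) (antip_upto_is_linear N).

Definition antip : {malg K[B]} -> {malg K[B]} :=
  lext (fun b : B => antip_upto (deg b) << b >>).

HB.instance Definition _ := GRing.Linear.on antip.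

(** The number of terms of the series may be chosen uniformly for all [b] of
    degree at most [N]; this makes [antip] a fixed linear combination of
    convolution powers on all factors of a coproduct. *)
Lemma antip_uptoE N b : (deg b <= N)%N -> antip << b >> = antip_upto N << b >>.
Proof.
move=> bN; rewrite /antip lextU /antip_upto.
rewrite (big_ord_widen N.+1 (fun k => (-1) ^+ k *: aug_pow k << b >>)) //=.
rewrite [RHS](bigID (fun k : 'I_N.+1 => (k < (deg b).+1)%N)) /=.
rewrite [X in _ + X]big1 ?addr0 // => k; rewrite -leqNgt => bk.
by rewrite aug_pow_eq0 ?scaler0.
Qed.

(** Since the identity is [aug] plus the convolution unit, convolving the [k]-th
    power of [aug] with it gives [aug_pow k.+1 + aug_pow k]. *)
Lemma aug_pow_telescope N b : (deg b <= N)%N ->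
  \sum_(k < N.+1) (-1) ^+ k *: (aug_pow k.+1 << b >> + aug_pow k << b >>)
  = conv_unit << b >>.
Proof.
move=> bN; pose F k : {malg K[B]} := (-1) ^+ k *: aug_pow k << b >>.
rewrite (eq_bigr (fun k : 'I_N.+1 => - (F k.+1 - F k))) => [|k _]; last first.
  by rewrite /F exprS mulN1r scaleNr opprB opprK addrC scalerDr.
rewrite sumrN -(big_mkord xpredT (fun k => F k.+1 - F k)) telescope_sumr //.
by rewrite /F aug_pow_eq0 // scaler0 sub0r opprK scale1r.
Qed.

Lemma conv_upto_l N f x :
  conv (antip_upto N) f x = \sum_(k < N.+1) (-1) ^+ k *: conv (aug_pow k) f x.
Proof.
rewrite /conv /= /tmap (eq_lext (g := fun p : B * B =>
   \sum_(k < N.+1) (-1) ^+ k *: tens (aug_pow k << p.1 >>) (f << p.2 >>))).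
  rewrite lext_sum linear_sum; apply: eq_bigr => k _; exact: linearZ.
move=> p; rewrite -/(tensl _ _) linear_sum.
by apply: eq_bigr => k _; rewrite linearZ.
Qed.

Lemma conv_upto_r N f x :
  conv f (antip_upto N) x = \sum_(k < N.+1) (-1) ^+ k *: conv f (aug_pow k) x.
Proof.
rewrite /conv /= /tmap (eq_lext (g := fun p : B * B =>
   \sum_(k < N.+1) (-1) ^+ k *: tens (f << p.1 >>) (aug_pow k << p.2 >>))).
  rewrite lext_sum linear_sum; apply: eq_bigr => k _; exact: linearZ.
by move=> p; rewrite linear_sum; apply: eq_bigr => k _; rewrite linearZ.
Qed.

Lemma conv_id_l f x : conv id f x = conv aug f x + f x.
Proof.
rewrite -[in X in _ = _ + X](conv1l f x) /conv /= -linearD -lextD.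
congr (hmul H _); apply: eq_lext => p.
by rewrite -/(tensl _ (aug _)) -/(tensl _ (conv_unit _)) -linearD subrK.
Qed.

Lemma conv_id_r f x : conv f id x = conv f aug x + f x.
Proof.
rewrite -[in X in _ = _ + X](conv1r f x) /conv /= -linearD -lextD.
by congr (hmul H _); apply: eq_lext => p; rewrite -linearD subrK.
Qed.

Lemma conv_antip_id b : conv antip id << b >> = conv_unit << b >>.
Proof.
rewrite -(@aug_pow_telescope (deg b) b) //.
have -> : conv antip id << b >> = conv (antip_upto (deg b)) idfun << b >>.
  apply: (congr1 (hmul H)); apply: eq_tmap_supp => // p /cop_deg pb.
  by rewrite (antip_uptoE (N := deg b)) // -pb leq_addr.
rewrite conv_upto_l; apply: eq_bigr => k _; congr (_ *: _).
by rewrite [LHS]conv_id_r aug_pow_comm.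
Qed.

Lemma conv_id_antip b : conv id antip << b >> = conv_unit << b >>.
Proof.
rewrite -(@aug_pow_telescope (deg b) b) //.
have -> : conv id antip << b >> = conv idfun (antip_upto (deg b)) << b >>.
  apply: (congr1 (hmul H)); apply: eq_tmap_supp => // p /cop_deg pb.
  by rewrite (antip_uptoE (N := deg b)) // -pb leq_addl.
rewrite conv_upto_r; apply: eq_bigr => k _; congr (_ *: _).
by rewrite [LHS]conv_id_l.
Qed.

(** The antipode is the convolution inverse of the identity, which is the sum of
    the convolution unit and of [aug]. In a graded connected bialgebra the [k]-th
    convolution power of [aug] kills all degrees below [k], so the geometric
    series of the [(-1) ^+ k *: aug ^ k] is finite on each basis vector, and
    telescopes when convolved with the identity on either side. *)
Lemma antipode_exists :
  exists S : {linear {malg K[B]} -> {malg K[B]}}, forall x,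
    hmul H (tmap S id (hcop H x)) = (hcounit H x : K) *: hone H /\
    hmul H (tmap id S (hcop H x)) = (hcounit H x : K) *: hone H.
Proof.
exists antip => x; split.
- pose l : {linear {malg K[B]} -> _} := hmul H \o tmap antip id \o hcop H.
  by move: x; apply: (linear_malg_ext (f := l) (g := conv_unit)) conv_antip_id.
- pose l : {linear {malg K[B]} -> _} := hmul H \o tmap id antip \o hcop H.
  by move: x; apply: (linear_malg_ext (f := l) (g := conv_unit)) conv_id_antip.
Qed.

End Antipode.

(** * Words, standardization and the coalgebra of permutations *)

Local Arguments hmul : simpl never.
Local Arguments hcop : simpl never.
Local Arguments hcounit : simpl never.

Section Words.

Lemma card_ord_lt n m : (m <= n)%N -> #|[set k : 'I_n | (k < m)%N]| = m.
Proof.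
move=> mn; rewrite cardsE -sum1_card -(big_ord_widen _ (fun=> 1%N) mn).
by rewrite sum1_card card_ord.
Qed.

(** The value [s i] is the number of [j] such that [s j < s i]. *)
Lemma perm_order_eq n (s t : 'S_n) :
  (forall i j, (s i < s j)%N = (t i < t j)%N) -> s = t.
Proof.
move=> e; apply/permP => i; apply: val_inj => /=.
have cardE (u : 'S_n) : #|[set j | (u j < u i)%N]| = u i.
  rewrite -[RHS](card_ord_lt (ltnW (ltn_ord (u i)))).
  rewrite -[RHS](card_preimset _ (@perm_inj _ u)).
  by apply: eq_card => j; rewrite !inE.
by rewrite -cardE -[RHS]cardE; apply: eq_card => j; rewrite !inE e.
Qed.

Lemma size_word n (s : 'S_n) : size (word s) = n.
Proof. by rewrite size_map size_enum_ord. Qed.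

Lemma nth_word n (s : 'S_n) (i : 'I_n) : nth 0%N (word s) i = s i.
Proof. by rewrite (nth_map i) ?size_enum_ord // nth_ord_enum. Qed.

Lemma word_uniq n (s : 'S_n) : uniq (word s).
Proof.
by rewrite map_inj_uniq ?enum_uniq // => i j /val_inj/perm_inj.
Qed.

(** Words with the same standardization, when their letters are distinct. *)
Definition order_equiv (u v : seq nat) : Prop := size u = size v /\
  forall i j, (i < size u)%N -> (j < size u)%N ->
    (nth 0%N u i < nth 0%N u j)%N = (nth 0%N v i < nth 0%N v j)%N.

Lemma std_perm_equiv w : uniq w -> order_equiv (word (std_perm w)) w.
Proof.
move=> uw; split=> [|i j]; rewrite size_word // => iw jw.
by rewrite -(std_permP uw (Ordinal iw) (Ordinal jw)) -!nth_word.
Qed.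

Lemma order_equiv_take k u v :
  order_equiv u v -> order_equiv (take k u) (take k v).
Proof.
move=> [e h]; split=> [|i j]; rewrite !size_take_min ?e // !leq_min.
by move=> /andP[ik iu] /andP[jk ju]; rewrite !nth_take // h ?e.
Qed.

Lemma order_equiv_drop k u v :
  order_equiv u v -> order_equiv (drop k u) (drop k v).
Proof.
move=> [e h]; split=> [|i j]; rewrite !size_drop ?e // => iu ju.
by rewrite !nth_drop h // e -ltn_subRL.
Qed.

Lemma std_mkperms n (s : 'S_n) w :
  uniq w -> order_equiv w (word s) -> standardization w = mkperms s.
Proof.
move=> uw [e h]; rewrite size_word in e.
case: n / e s h => s h; congr mkperms; apply: perm_order_eq => i j.
by rewrite (std_permP uw) h ?nth_word.
Qed.

Lemma eq_std u v : uniq u -> uniq v -> order_equiv u v ->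
  standardization u = standardization v.
Proof.
move=> uu uv [e h]; apply: std_mkperms => //.
have [e' h'] := std_perm_equiv uv; split=> [|i j iu ju]; first by rewrite e'.
by rewrite h // h' // e' -e.
Qed.

Lemma std_word n (s : 'S_n) : standardization (word s) = mkperms s.
Proof. by apply: std_mkperms; first exact: word_uniq. Qed.

Variable K : fieldType.

(** Standardization commutes with cutting, so the coproduct can be computed on
    any word with distinct letters instead of its standardization. This reduces
    coassociativity to cutting a word in three pieces. *)
Lemma hcop_std w : uniq w -> hcop (FQSym K) << standardization w >> =
  \sum_(k < (size w).+1)
    << (standardization (take k w), standardization (drop k w)) >>.
Proof.
move=> uw; rewrite [LHS]lextU; apply: eq_bigr => k _ /=.
have eqw := std_perm_equiv uw; have us := word_uniq (std_perm w).
have -> : standardization (take k (word (std_perm w))) =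
    standardization (take k w).
  by apply: eq_std; rewrite ?take_uniq //; apply: order_equiv_take.
have -> // : standardization (drop k (word (std_perm w))) =
    standardization (drop k w).
by apply: eq_std; rewrite ?drop_uniq //; apply: order_equiv_drop.
Qed.

Lemma perms_word (p : perms) : exists2 w, uniq w & p = standardization w.
Proof. by case: p => n s; exists (word s); rewrite ?word_uniq ?std_word. Qed.

(** Cutting at [k] and then the first piece at [l], or cutting at [l] and then
    the second piece: the pairs of cuts [l <= k] are enumerated in two ways. *)
Lemma triangular_exchange (V : zmodType) n (F : nat -> nat -> V) :
  \sum_(k < n.+1) \sum_(l < k.+1) F l k =
  \sum_(l < n.+1) \sum_(k < (n - l).+1) F l (k + l)%N.
Proof.
transitivity (\sum_(k < n.+1) \sum_(l < n.+1 | (l <= k)%N) F l k).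
  by apply: eq_bigr => k _; rewrite (big_ord_widen _ (F^~ k) (ltn_ord k)).
rewrite (exchange_big_dep xpredT) //=; apply: eq_bigr => l _.
rewrite -(big_geq_mkord l n.+1 xpredT (F l)) -{1}[l : nat]add0n big_addn.
by rewrite big_mkord subSn // -ltnS.
Qed.

Lemma FQSym_coalgebra : coalgebra_laws (FQSym K).
Proof.
split.
- have copE := hcop_std; move: (hcop (FQSym K)) copE => cop copE.
  pose l : {linear {malg K[perms]} -> _} :=
    @tassoc K perms perms perms \o tmap cop id \o cop.
  pose r : {linear {malg K[perms]} -> _} := tmap id cop \o cop.
  suff: l =1 r by exact.
  apply: linear_malg_ext => p; have [w uw ->] := perms_word p.
  rewrite /= copE // (linear_sum (tmap cop id)) (linear_sum (tmap id cop)).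
  rewrite (linear_sum (@tassoc K _ _ _)) /=.
  pose F l k : {malg K[(perms * (perms * perms))%type]} :=
    << (standardization (take l w), (standardization (drop l (take k w)),
       standardization (drop k w))) >>.
  transitivity (\sum_(k < (size w).+1) \sum_(l < k.+1) F l k).
    apply: eq_bigr => k _; rewrite tmapU copE ?take_uniq //.
    have -> : size (take k w) = k by rewrite size_takel // -ltnS.
    rewrite -/(tensl << standardization (drop k w) >> _).
    rewrite (linear_sum (tensl _)) (linear_sum (@tassoc K _ _ _)).
    apply: eq_bigr => l' _; rewrite /= /tensl tensU /tassoc lextU /F /=.
    by rewrite take_takel // -ltnS.
  rewrite triangular_exchange; apply: eq_bigr => l' _.
  rewrite tmapU copE ?drop_uniq // size_drop (linear_sum (tens _)).
  apply: eq_bigr => k _; rewrite /= tensU /F.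
  by rewrite take_drop drop_drop.
- pose l : {linear {malg K[perms]} -> _} := lext (fun p : perms * perms =>
    (hcounit (FQSym K) << p.1 >> : K) *: << p.2 >>) \o hcop (FQSym K).
  apply: (linear_malg_ext (f := l) (g := idfun)) => p.
  have [w uw ->] := perms_word p; rewrite /= hcop_std // (linear_sum (lext _)) /=.
  rewrite big_ord_recl /= big1 => [|k _]; rewrite !lextU /=.
    by rewrite take0 drop0 scale1r addr0.
  by rewrite size_takel ?(ltn_ord k) // scale0r.
- pose l : {linear {malg K[perms]} -> _} := lext (fun p : perms * perms =>
    (hcounit (FQSym K) << p.2 >> : K) *: << p.1 >>) \o hcop (FQSym K).
  apply: (linear_malg_ext (f := l) (g := idfun)) => p.
  have [w uw ->] := perms_word p; rewrite /= hcop_std // (linear_sum (lext _)) /=.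
  rewrite big_ord_recr /= big1 => [|k _]; rewrite !lextU /=.
    by rewrite drop_size take_size scale1r add0r.
  by rewrite size_drop subn_eq0 leqNgt ltn_ord scale0r.
Qed.

End Words.

(** * Embeddings of double posets *)

Section Embeddings.

Definition dposet_emb (T U : finType) (P : dposet T) (Q : dposet U)
    (f : T -> U) : Prop :=
  [/\ injective f, forall x y, Q.1 (f x) (f y) = P.1 x y &
      forall x y, Q.2 (f x) (f y) = P.2 x y].

Lemma dposet_emb_comp (T U V : finType) (P : dposet T) (Q : dposet U)
    (R : dposet V) f g :
  dposet_emb P Q f -> dposet_emb Q R g -> dposet_emb P R (g \o f).
Proof.
case=> f0 f1 f2 [g0 g1 g2]; split; first exact: inj_comp.
  by move=> x y /=; rewrite g1.
by move=> x y /=; rewrite g2.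
Qed.

(** Isomorphisms are kept as surjective embeddings, which compose with embeddings
    into larger double posets. *)
Lemma dposet_isoP (T U : finType) (P : dposet T) (Q : dposet U) :
  dposet_iso P Q <-> exists2 f, dposet_emb P Q f & f @: setT = setT.
Proof.
split=> [[f fb [f1 f2]]|[f [f0 f1 f2] fT]]; exists f => //.
- by split=> //; apply: bij_inj.
- have [g fK gK] := fb; apply/setP => y; rewrite inE.
  by rewrite -[y]gK imset_f ?inE.
- have fE y : y \in codom f.
    have: y \in f @: setT by rewrite fT inE.
    by case/imsetP=> x _ ->; apply: codom_f.
  exists (fun y => iinv (fE y)) => [x|y]; last exact: f_iinv.
  by apply: f0; rewrite f_iinv.
Qed.

(** Subposets of a product and products of subposets will be identified by
    embedding both into the same double poset with the same image. *)
Lemma dposet_emb_iso (T U V : finType) (P : dposet T) (Q : dposet U)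
    (R : dposet V) f g :
  dposet_emb P R f -> dposet_emb Q R g -> f @: setT = g @: setT ->
  dposet_iso P Q.
Proof.
move=> [f0 f1 f2] [g0 g1 g2] e.
have fE x : f x \in codom g.
  have: f x \in g @: setT by rewrite -e imset_f ?inE.
  by case/imsetP=> y _ ->; apply: codom_f.
have gE y : g y \in codom f.
  have: g y \in f @: setT by rewrite e imset_f ?inE.
  by case/imsetP=> x _ ->; apply: codom_f.
exists (fun x => iinv (fE x)).
  exists (fun y => iinv (gE y)) => [x|y]; [apply: f0|apply: g0];
  by rewrite !f_iinv.
by split=> x y; rewrite -?g1 -?g2 !f_iinv ?f1 ?f2.
Qed.

Lemma isoclass_emb (T : finType) (P : dposet T) : special P ->
  exists2 f, dposet_emb (dposet_of (isoclass P)) P f & f @: setT = setT.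
Proof. by move/isoclass_iso/dposet_iso_sym/dposet_isoP. Qed.

Lemma sp_sub_emb (P : sposet) (A : {set 'I_(tag P)}) :
  exists2 f, dposet_emb (dposet_of (sp_sub P A)) (dposet_of P) f &
    f @: setT = A.
Proof.
have [|f fe fT] := @isoclass_emb _ (dposet_sub (dposet_of P) A).
  by move=> x y; rewrite !mk_porderE; exact: special_dposet_of.
exists (val \o f).
  apply: dposet_emb_comp fe _; split=> [|x y|x y]; first exact: val_inj.
    by rewrite [RHS]mk_porderE.
  by rewrite [RHS]mk_porderE.
rewrite imset_comp fT; apply/setP => x; apply/imsetP/idP => [[y _ ->]|xA].
  exact: valP.
by exists (exist _ x xA).
Qed.

Lemma special_mul (T U : finType) (P : dposet T) (Q : dposet U) :
  special P -> special Q -> special (dposet_mul P Q).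
Proof. by move=> sP sQ [x|x] [y|y]; rewrite !mk_porderE //=. Qed.

Lemma sp_mul_iso (P Q : sposet) :
  dposet_iso (dposet_mul (dposet_of P) (dposet_of Q)) (dposet_of (sp_mul P Q)).
Proof. by apply/isoclass_iso/special_mul; exact: special_dposet_of. Qed.

Definition sum_map (T U T' U' : Type) (f : T -> T') (g : U -> U') (z : T + U) :=
  match z with inl x => inl (f x) | inr y => inr (g y) end.

Lemma dposet_emb_mul (T U T' U' : finType) (P : dposet T) (Q : dposet U)
    (P' : dposet T') (Q' : dposet U') f g :
  dposet_emb P P' f -> dposet_emb Q Q' g ->
  dposet_emb (dposet_mul P Q) (dposet_mul P' Q') (sum_map f g).
Proof.
move=> [f0 f1 f2] [g0 g1 g2]; split.
- by move=> [x|x] [y|y] //= [] => [/f0|/g0] ->.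
- by move=> [x|x] [y|y]; rewrite !mk_porderE /=.
- by move=> [x|x] [y|y]; rewrite !mk_porderE /=.
Qed.

Lemma dposet_iso_mul (T U T' U' : finType) (P : dposet T) (Q : dposet U)
    (P' : dposet T') (Q' : dposet U') :
  dposet_iso P P' -> dposet_iso Q Q' ->
  dposet_iso (dposet_mul P Q) (dposet_mul P' Q').
Proof.
move=> /dposet_isoP[f fe fT] /dposet_isoP[g ge gT]; apply/dposet_isoP.
exists (sum_map f g); first exact: dposet_emb_mul.
apply/setP => -[x|y]; rewrite [RHS]inE; apply/imsetP.
  have: x \in f @: setT by rewrite fT inE.
  by case/imsetP=> x' _ ->; exists (inl x').
have: y \in g @: setT by rewrite gT inE.
by case/imsetP=> y' _ ->; exists (inr y').
Qed.

Lemma dposet_iso_refl (T : finType) (P : dposet T) : dposet_iso P P.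
Proof. by exists id => //; exists id. Qed.

Lemma sp_mulA : associative sp_mul.
Proof.
move=> P Q R; apply: sposet_iso_eq; apply: dposet_iso_trans _ (sp_mul_iso _ _).
apply: dposet_iso_trans (dposet_iso_sym (sp_mul_iso _ _)) _.
apply: dposet_iso_trans
  (dposet_iso_mul (dposet_iso_refl _) (dposet_iso_sym (sp_mul_iso _ _))) _.
apply: dposet_iso_trans _
  (dposet_iso_mul (sp_mul_iso _ _) (dposet_iso_refl _)).
exists (fun z => match z with
  | inl x => inl (inl x) | inr (inl x) => inl (inr x) | inr (inr x) => inr x
  end).
  exists (fun z => match z with
    | inl (inl x) => inl x | inl (inr x) => inr (inl x) | inr x => inr (inr x)
    end).
    by case=> [x|[x|x]].
  by case=> [[x|x]|x].
split=> [] [x|[x|x]] [y|[y|y]]; do 3 rewrite ?mk_porderE /=; by [].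
Qed.

Lemma sp_mul1l : left_id sp_one sp_mul.
Proof.
move=> P; apply: sposet_iso_eq.
apply: dposet_iso_trans (dposet_iso_sym (sp_mul_iso _ _)) _.
apply/dposet_iso_sym/dposet_isoP; exists inr.
  by split=> [x y []|x y|x y] //; rewrite [LHS]mk_porderE.
by apply/setP => -[[]//|y]; rewrite inE imset_f ?inE.
Qed.

Lemma sp_mul1r : right_id sp_one sp_mul.
Proof.
move=> P; apply: sposet_iso_eq.
apply: dposet_iso_trans (dposet_iso_sym (sp_mul_iso _ _)) _.
apply/dposet_iso_sym/dposet_isoP; exists inl.
  by split=> [x y []|x y|x y] //; rewrite [LHS]mk_porderE.
by apply/setP => -[y|[]//]; rewrite inE imset_f ?inE.
Qed.

Lemma tag_sp_mul (P Q : sposet) : tag (sp_mul P Q) = (tag P + tag Q)%N.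
Proof. by rewrite /= card_sum !card_ord. Qed.

Lemma tag_sp_sub (P : sposet) (A : {set 'I_(tag P)}) : tag (sp_sub P A) = #|A|.
Proof. by rewrite /= card_sig. Qed.

Lemma sposet_tag0 (P : sposet) : (tag P == 0%N) = (P == sp_one).
Proof.
apply/eqP/eqP => [|-> //]; case: P => n r /= e; case: _ / (esym e) r => r.
by congr Tagged; apply: porder_ext => -[].
Qed.

Section SubMul.
Variables (P Q : sposet).
Variable f : 'I_(tag P) + 'I_(tag Q) -> 'I_(tag (sp_mul P Q)).
Hypothesis fE :
  dposet_emb (dposet_mul (dposet_of P) (dposet_of Q)) (dposet_of (sp_mul P Q)) f.
Hypothesis fT : f @: setT = setT.
Variable A : {set 'I_(tag (sp_mul P Q))}.

Let fl (x : 'I_(tag P)) := f (inl x).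
Let fr (x : 'I_(tag Q)) := f (inr x).

Lemma upper_set_mul : upper_set (tagged (sp_mul P Q)) A =
  upper_set (tagged P) (fl @^-1: A) && upper_set (tagged Q) (fr @^-1: A).
Proof.
have [_ f1 _] := fE.
have fR x y : tagged (sp_mul P Q) (f x) (f y) =
    sum_rel false (tagged P) (tagged Q) x y.
  by rewrite [LHS]f1 mk_porderE.
apply/forall_inP/andP => [up|[/forall_inP upl /forall_inP upr] z zA].
  split; apply/forall_inP => x; rewrite inE => /up/forallP xA; apply/forallP => y.
    by rewrite inE; have := xA (fl y); rewrite fR.
  by rewrite inE; have := xA (fr y); rewrite fR.
have imf u : exists x, u = f x.
  have: u \in f @: setT by rewrite fT inE.
  by case/imsetP=> x _ ->; exists x.
apply/forallP => t; have [[x ex] [y ey]] := (imf z, imf t).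
rewrite ex ey fR; rewrite ex in zA.
case: x y {ex ey} zA => [x|x] [y|y] //= xA.
  have /upl/forallP/(_ y) : x \in fl @^-1: A by rewrite inE.
  by rewrite inE.
have /upr/forallP/(_ y) : x \in fr @^-1: A by rewrite inE.
by rewrite inE.
Qed.

(** Inside a product [P Q], a subset [A] is a disjoint union of a subset of [P]
    and one of [Q]; it is an upper set iff both are, and the subposet on [A] is
    the product of the two subposets. This is the compatibility of the coproduct
    with the product, on basis elements. *)
Lemma sp_sub_mul :
  sp_sub (sp_mul P Q) A = sp_mul (sp_sub P (fl @^-1: A)) (sp_sub Q (fr @^-1: A)).
Proof.
have [f0 f1 _] := fE.
have [h hE hA] := sp_sub_emb A.
have [p pE pA] := sp_sub_emb (fl @^-1: A).
have [q qE qA] := sp_sub_emb (fr @^-1: A).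
have [m mE mT] : exists2 m, dposet_emb
    (dposet_of (sp_mul (sp_sub P (fl @^-1: A)) (sp_sub Q (fr @^-1: A))))
    (dposet_mul (dposet_of (sp_sub P (fl @^-1: A)))
      (dposet_of (sp_sub Q (fr @^-1: A)))) m & m @: setT = setT.
  exact/dposet_isoP/dposet_iso_sym/sp_mul_iso.
apply: sposet_iso_eq; apply: dposet_emb_iso hE
  (dposet_emb_comp mE (dposet_emb_comp (dposet_emb_mul pE qE) fE)) _.
rewrite hA imset_comp mT; apply/setP => z; apply/idP/imsetP => [zA|[[x|x] _ ->]].
- have: z \in f @: setT by rewrite fT inE.
  case/imsetP=> -[x|x] _ ez.
    have: x \in p @: setT by rewrite pA inE /fl -ez.
    by case/imsetP=> y _ ey; exists (inl y); [rewrite inE|rewrite ez ey].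
  have: x \in q @: setT by rewrite qA inE /fr -ez.
  by case/imsetP=> y _ ey; exists (inr y); [rewrite inE|rewrite ez ey].
- by have: p x \in p @: setT; [rewrite imset_f ?inE|rewrite pA inE].
- by have: q x \in q @: setT; [rewrite imset_f ?inE|rewrite qA inE].
Qed.

Lemma set_split_bij : bijective (fun A : {set 'I_(tag (sp_mul P Q))} =>
  (fl @^-1: A, fr @^-1: A)).
Proof.
have [f0 _ _] := fE.
exists (fun IJ : {set 'I_(tag P)} * {set 'I_(tag Q)} =>
  f @: [set z | match z with inl x => x \in IJ.1 | inr y => y \in IJ.2 end]).
  move=> C; apply/setP => z; apply/imsetP/idP => [[[x|x]]|zC].
  - by rewrite !inE => xC ->.
  - by rewrite !inE => xC ->.
  have: z \in f @: setT by rewrite fT inE.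
  case/imsetP=> x _ ez; exists x => //; rewrite inE.
  by case: x ez => x ez; rewrite inE ez in zC *.
by move=> [I J]; congr (_, _); apply/setP => x;
   rewrite inE (mem_imset _ _ f0) inE.
Qed.

End SubMul.

End Embeddings.

(** * The bialgebra of special plane posets *)

Section SpecialPlane.
Variable K : fieldType.

Lemma hmul_spp (P Q : spposet) :
  hmul (HSPP K) << (P, Q) >> = << spp_mul P Q >>.
Proof. exact: lextU. Qed.

Lemma hcop_spp (P : spposet) : hcop (HSPP K) << P >> =
  \sum_(A : {set 'I_(tag (val P))} | upper_set (tagged (val P)) A)
    << (spp_sub P (~: A), spp_sub P A) >>.
Proof. exact: lextU. Qed.

Lemma hcounit_spp (P : spposet) :
  hcounit (HSPP K) << P >> = (tag (val P) == 0%N)%:R.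
Proof. by rewrite [LHS]lextU sposet_tag0. Qed.

Lemma spp_mulA (P Q R : spposet) :
  spp_mul P (spp_mul Q R) = spp_mul (spp_mul P Q) R.
Proof. by apply: val_inj; apply: sp_mulA. Qed.

Lemma hmulA_spp (x : {malg K[(spposet * spposet * spposet)%type]}) :
  hmul (HSPP K) (tmap (hmul (HSPP K)) id x) =
  hmul (HSPP K) (tmap id (hmul (HSPP K)) (tassoc x)).
Proof.
have mulE := hmul_spp; move: (hmul (HSPP K)) mulE => mul mulE.
pose l : {linear {malg K[(spposet * spposet * spposet)%type]} -> _} :=
  mul \o tmap mul id.
pose r : {linear {malg K[(spposet * spposet * spposet)%type]} -> _} :=
  mul \o tmap id mul \o @tassoc K _ _ _.
suff: l =1 r by exact.
apply: linear_malg_ext => -[[P Q] R] /=; rewrite /tassoc lextU /=.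
rewrite (tmapUU (f := mul) (g := id) (mulE P Q) (erefl << R >>)).
rewrite (mulE _ R).
rewrite (tmapUU (f := id) (g := mul) (erefl << P >>) (mulE Q R)).
by rewrite (mulE P _) spp_mulA.
Qed.

Lemma hmul1l_spp x : hmul (HSPP K) (tens (hone (HSPP K)) x) = x.
Proof.
pose l : {linear {malg K[spposet]} -> _} :=
  hmul (HSPP K) \o tens (hone (HSPP K)).
apply: (linear_malg_ext (f := l) (g := idfun)) => P.
transitivity (hmul (HSPP K) << (spp_one, P) >>).
  by rewrite -tensU.
rewrite hmul_spp; suff -> : spp_mul spp_one P = P by [].
by apply: val_inj; apply: sp_mul1l.
Qed.

Lemma hmul1r_spp x : hmul (HSPP K) (tens x (hone (HSPP K))) = x.
Proof.
pose l : {linear {malg K[spposet]} -> _} :=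
  hmul (HSPP K) \o tensl (hone (HSPP K)).
apply: (linear_malg_ext (f := l) (g := idfun)) => P.
transitivity (hmul (HSPP K) << (P, spp_one) >>).
  by rewrite -tensU.
rewrite hmul_spp; suff -> : spp_mul P spp_one = P by [].
by apply: val_inj; apply: sp_mul1r.
Qed.

Lemma hcounitM_spp (x y : {malg K[spposet]}) :
  hcounit (HSPP K) (hmul (HSPP K) (tens x y)) =
  (hcounit (HSPP K) x : K) * hcounit (HSPP K) y.
Proof.
have [mulE couE] := (hmul_spp, hcounit_spp).
move: (hmul (HSPP K)) (hcounit (HSPP K)) mulE couE => mul cou mulE couE.
have UE P : cou (mul (tens << P >> y)) = (cou << P >> : K) * cou y.
  rewrite {2}[y]malg_expand {1}[y]malg_expand (linear_sum (tens << P >>)).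
  rewrite (linear_sum mul) 2!(linear_sum cou) mulr_sumr.
  apply: eq_bigr => Q _ /=.
  rewrite [tens _ _]linearZ [mul _]linearZ [cou (_ *: mul _)]linearZ.
  rewrite [cou (_ *: << Q >>)]linearZ mulrCA; congr (_ * _).
  have ePQ : tag (val (spp_mul P Q)) = (tag (val P) + tag (val Q))%N.
    exact: tag_sp_mul.
  rewrite /= tensU mulE; move: (spp_mul P Q) ePQ => PQ ePQ.
  apply: (etrans (couE PQ) (etrans _ (esym (f_equal2 *%R (couE P) (couE Q))))).
  by rewrite ePQ addn_eq0 -natrM mulnb.
have tlE z : tens z y = tensl y z by [].
rewrite {2}[x]malg_expand {1}[x]malg_expand tlE (linear_sum (tensl y)).
rewrite (linear_sum mul) 2!(linear_sum cou) mulr_suml.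
apply: eq_bigr => P _ /=.
rewrite [tensl _ _]linearZ [mul _]linearZ [cou (_ *: mul _)]linearZ.
rewrite [cou (_ *: << P >>)]linearZ /= /tensl UE; exact: mulrA.
Qed.

Lemma hcopM_spp (x : {malg K[(spposet * spposet)%type]}) :
  hcop (HSPP K) (hmul (HSPP K) x) = tmap (hmul (HSPP K)) (hmul (HSPP K))
    (tswap (tmap (hcop (HSPP K)) (hcop (HSPP K)) x)).
Proof.
have [mulE copE] := (hmul_spp, hcop_spp).
move: (hmul (HSPP K)) (hcop (HSPP K)) mulE copE => mul cop mulE copE.
pose l : {linear {malg K[(spposet * spposet)%type]} -> _} := cop \o mul.
pose L : {linear {malg K[(spposet * spposet * (spposet * spposet))%type]} -> _}
  := tmap mul mul \o @tswap K _.
pose r : {linear {malg K[(spposet * spposet)%type]} -> _} := L \o tmap cop cop.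
suff: l =1 r by exact.
apply: linear_malg_ext => -[P Q].
apply: (etrans (congr1 cop (mulE P Q))); apply: (etrans (copE (spp_mul P Q))).
apply: (etrans _ (congr1 L (esym (tmapU cop cop P Q)))).
apply: (etrans _ (congr1 L (esym (f_equal2 (@tens K _ _) (copE P) (copE Q))))).
have LU a b c d : L << ((a, b), (c, d)) >> = << (spp_mul a c, spp_mul b d) >>.
  rewrite [LHS]/(tmap mul mul (tswap _)) /tswap lextU /=.
  exact: tmapUU (mulE _ _) (mulE _ _).
apply: (etrans _ (congr1 L (esym (tens_sum _ _ _ _ _ _)))).
rewrite (linear_sum L); under [RHS]eq_bigr do rewrite (linear_sum L).
rewrite pair_big_dep /=.
have [f fE fT] : exists2 f, dposet_emb
    (dposet_mul (dposet_of (val P)) (dposet_of (val Q)))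
    (dposet_of (sp_mul (val P) (val Q))) f & f @: setT = setT.
  exact/dposet_isoP/sp_mul_iso.
rewrite [RHS](reindex _ (onW_bij _ (set_split_bij fE fT))) /=.
apply: eq_big => [A|A _]; first exact: upper_set_mul fE fT A.
apply: esym; apply: etrans (congr1 L (tensU _ _ _)) (etrans (LU _ _ _ _) _).
apply: (congr1 (fun p => << p >>)); apply: (f_equal2 pair); apply: val_inj.
  by rewrite /= (sp_sub_mul fE fT) !preimsetC.
by rewrite /= (sp_sub_mul fE fT).
Qed.

Lemma spp_tag0 (P : spposet) : (tag (val P) == 0%N) = (P == spp_one).
Proof. by rewrite sposet_tag0. Qed.

Lemma hcop1_spp :
  hcop (HSPP K) (hone (HSPP K)) = tens (hone (HSPP K)) (hone (HSPP K)).
Proof.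
apply: (etrans (hcop_spp spp_one)); apply: (etrans _ (esym (tensU _ _ _))).
rewrite (big_pred1 set0) => [|A]; last first.
  have -> : A = set0 by apply/setP => -[].
  by rewrite /= eqxx; apply/forall_inP => -[].
apply: (congr1 (fun p => << p >>)).
by apply: (f_equal2 pair); apply/eqP; rewrite -spp_tag0 tag_sp_sub;
   apply/eqP/eq_card0 => -[].
Qed.

Lemma cop_deg_spp (P : spposet) : {in msupp (hcop (HSPP K) << P >>),
  forall p, (tag (val p.1) + tag (val p.2))%N = tag (val P)}.
Proof.
move=> p; rewrite hcop_spp => /msupp_sum_basis[A _ ->] /=.
by rewrite !card_sig addnC cardsC card_ord.
Qed.

(** Cardinality is a grading for which the degree 0 part is spanned by the unit,
    so the bialgebra laws already provide the antipode. *)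
Lemma HSPP_hopf : coalgebra_laws (HSPP K) -> hopf_algebra (HSPP K).
Proof.
move=> co; have [coA cl cr] := co; split => //.
- exact: hmulA_spp.
- exact: hmul1l_spp.
- exact: hmul1r_spp.
- exact: hcop1_spp.
- exact: hcopM_spp.
- by rewrite [LHS]hcounit_spp.
- exact: hcounitM_spp.
- apply: (antipode_exists (deg := fun P : spposet => tag (val P))
    (b1 := spp_one)) => //.
  + exact: hmulA_spp.
  + exact: hmul1l_spp.
  + exact: hmul1r_spp.
  + exact: hcounit_spp.
  + exact: spp_tag0.
  + exact: cop_deg_spp.
Qed.

End SpecialPlane.

(** * Linear extensions as compatible words *)

Section CompatibleWords.

(** A word is compatible with [r] when no letter comes before a letter that is
    smaller for [r]: on words listing each element once, these are the linear
    extensions. Written as a [pairwise] condition, it behaves well under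
    concatenation, maps and filtering. *)
Definition compat (T : Type) (r : rel T) : pred (seq T) :=
  pairwise (fun x y => ~~ r y x).

Definition letters n (s : 'S_n) : seq 'I_n := [seq s i | i <- enum 'I_n].

Lemma word_letters n (s : 'S_n) : word s = map val (letters s).
Proof. by rewrite -map_comp. Qed.

Lemma size_letters n (s : 'S_n) : size (letters s) = n.
Proof. by rewrite size_map size_enum_ord. Qed.

Lemma letters_uniq n (s : 'S_n) : uniq (letters s).
Proof. by rewrite map_inj_uniq ?enum_uniq //; apply: perm_inj. Qed.

Lemma nth_letters n (s : 'S_n) x0 (i : 'I_n) : nth x0 (letters s) i = s i.
Proof. by rewrite (nth_map i) ?size_enum_ord // nth_ord_enum. Qed.

Lemma letters_inj n : injective (@letters n).
Proof. by move=> s t e; apply/permP => i; rewrite -!(nth_letters _ i) e. Qed.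

Lemma linear_extensionE n (r : porder 'I_n) (s : 'S_n) :
  linear_extension r s = compat r (letters s).
Proof.
apply/forallP/idP => [le|/pairwiseP cs i].
  case: n r s le => [|n] r s le; first by rewrite /compat /letters enum_ord0.
  apply/(pairwiseP ord0) => i j; rewrite !inE size_letters => lti ltj ij.
  pose i' := Ordinal lti; pose j' := Ordinal ltj.
  rewrite -[i]/(val i') -[j]/(val j') !nth_letters; apply/negP => rji.
  have /forallP/(_ (s i'))/implyP := le (s j').
  rewrite rji !permK (inj_eq perm_inj) -(inj_eq val_inj) /= gtn_eqF // => /(_ isT).
  by rewrite ltnNge ltnW.
apply/forallP => j; apply/implyP => /andP[ne rij]; rewrite ltnNge.
have [r0 _ _] := rel_ofP r.
rewrite leq_eqVlt; apply/norP; split.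
  by apply: contra ne => /eqP/val_inj/perm_inj ->.
apply/negP => ji; have := cs i ((s^-1)%g j) ((s^-1)%g i).
by rewrite !inE size_letters !ltn_ord => /(_ isT isT ji);
   rewrite !nth_letters !permKV rij.
Qed.

Lemma uniq_subset_perm (T : eqType) (s t : seq T) :
  uniq s -> uniq t -> {subset s <= t} -> size s = size t -> perm_eq s t.
Proof.
move=> us ut st e; apply: uniq_perm => //.
by have [] := uniq_min_size us st; rewrite ?e.
Qed.

Lemma mem_letters n (s : 'S_n) : perm_eq (letters s) (enum 'I_n).
Proof.
apply: uniq_subset_perm; rewrite ?letters_uniq ?enum_uniq //.
  by move=> i _; rewrite mem_enum.
by rewrite size_letters size_enum_ord.
Qed.

Lemma letters_permutations n :
  perm_eq [seq letters s | s <- index_enum 'S_n] (permutations (enum 'I_n)).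
Proof.
apply: uniq_subset_perm.
- by rewrite (map_inj_uniq (@letters_inj n)) index_enum_uniq.
- exact: permutations_uniq.
- by move=> w /mapP[s _ ->]; rewrite mem_permutations mem_letters.
- rewrite size_map size_permutations ?enum_uniq // size_enum_ord.
  by rewrite -card_Sn cardE enumT [index_enum _]unlock.
Qed.

Lemma sum_letters (V : nmodType) n (P : pred (seq 'I_n)) (F : seq 'I_n -> V) :
  \sum_(s : 'S_n | P (letters s)) F (letters s) =
  \sum_(w <- permutations (enum 'I_n) | P w) F w.
Proof. by rewrite -(perm_big _ (letters_permutations n)) big_map. Qed.

(** Both sides are duplicate-free lists of factorial length, so one inclusion is
    enough. *)
Lemma permutations_map (T U : eqType) (e : T -> U) s t :
  injective e -> uniq t -> perm_eq (map e s) t ->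
  perm_eq [seq map e w | w <- permutations s] (permutations t).
Proof.
move=> eI ut est; have us : uniq s by rewrite -(map_inj_uniq eI) (perm_uniq est).
apply: uniq_subset_perm.
- by rewrite map_inj_uniq ?permutations_uniq //; apply: inj_map.
- exact: permutations_uniq.
- move=> w /mapP[u]; rewrite !mem_permutations => us' ->.
  exact: perm_trans (perm_map e us') est.
- by rewrite size_map !size_permutations // -(perm_size est) size_map.
Qed.

(** A concatenation [u ++ v] is compatible iff both pieces are and no letter of
    [u] lies above a letter of [v], that is, iff moreover the letters of [v] form
    an upper set. So cutting a compatible word in two amounts to choosing an
    upper set and compatible words on it and on its complement. *)
Lemma sum_cut_compat (V : nmodType) (T : finType) (r : rel T)
    (G : seq T -> seq T -> V) :
  \sum_(w <- permutations (enum T) | compat r w)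
    \sum_(k < #|T|.+1) G (take k w) (drop k w) =
  \sum_(A : {set T} | upper_set r A)
    \sum_(u <- permutations (enum (~: A)) | compat r u)
      \sum_(v <- permutations (enum A) | compat r v) G u v.
Proof.
pose L := [seq (take k w, drop k w) | w <- [seq w <- permutations (enum T) |
  compat r w], k <- iota 0 #|T|.+1].
pose cs (A : {set T}) := [seq w <- permutations (enum A) | compat r w].
pose M := [seq p | A <- [seq A <- index_enum {set T} | upper_set r A],
  p <- [seq (u, v) | u <- cs (~: A), v <- cs A]].
transitivity (\sum_(p <- L) G p.1 p.2).
  rewrite big_allpairs_dep big_filter; apply: eq_bigr => w _ /=.
  by rewrite -(big_mkord xpredT (fun k => G (take k w) (drop k w))) /index_iota subn0.
transitivity (\sum_(p <- M) G p.1 p.2); last first.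
  rewrite big_allpairs_dep big_filter; apply: eq_bigr => A _ /=.
  rewrite big_allpairs_dep big_filter; apply: eq_bigr => u _ /=.
  by rewrite big_filter.
apply: perm_big; apply: uniq_perm.
(* The pieces determine the word, and the length of the first one the cut. *)
- rewrite allpairs_uniq ?filter_uniq ?permutations_uniq ?iota_uniq //.
  move=> [w k] [w' k'] /allpairsPdep[w1 [k1 [w1P k1P [-> ->]]]].
  move=> /allpairsPdep[w2 [k2 [w2P k2P [-> ->]]]] /= [e1 e2].
  have sz w0 : w0 \in [seq w <- permutations (enum T) | compat r w] ->
      size w0 = #|T|.
    rewrite mem_filter mem_permutations => /andP[_ /perm_size ->].
    by rewrite -cardE.
  move: k1P k2P; rewrite !mem_iota !add0n !ltnS => k1P k2P.
  congr (_, _); first by rewrite -(cat_take_drop k1 w1) e1 e2 cat_take_drop.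
  by have := congr1 size e1; rewrite !size_takel ?sz.
(* The upper set is recovered as the set of letters of the second piece. *)
- have csP (A : {set T}) u : u \in cs A -> u =i A.
    rewrite mem_filter mem_permutations => /andP[_ /perm_mem e] x.
    by rewrite e mem_enum.
  rewrite allpairs_uniq_dep ?filter_uniq ?index_enum_uniq //.
    move=> A _; rewrite allpairs_uniq ?filter_uniq ?permutations_uniq //.
    by move=> [? ?] [? ?].
  move=> _ _ /allpairsPdep[A [p [_ pA ->]]] /allpairsPdep[A' [p' [_ pA' ->]]] /= ep.
  move: pA pA'; rewrite -ep => /allpairsPdep[u [v [_ vA ->]]].
  move=> /allpairsPdep[u' [v' [_ vA' [_ e]]]]; rewrite -e in vA'.
  suff eA : A = A' by rewrite eA.
  by apply/setP => x; rewrite -(csP _ _ vA) (csP _ _ vA').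
- move=> [u v]; apply/allpairsPdep/allpairsPdep.
  + move=> [w [k [wP kP [-> ->]]]].
    move: wP; rewrite mem_filter mem_permutations => /andP[cw ew].
    have uw : uniq w by rewrite (perm_uniq ew) enum_uniq.
    have wT x : x \in w by rewrite (perm_mem ew) mem_enum.
    rewrite -(cat_take_drop k w) in cw uw wT.
    move: (take k w) (drop k w) cw uw wT => {u v w ew kP}u v cw uw wT.
    move: cw uw; rewrite /compat pairwise_cat cat_uniq.
    move=> /and3P[/allrelP ruv cu cv] /and3P[uu /hasPn nuv uv].
    exists [set x in v], (u, v); split=> //.
      rewrite mem_filter mem_index_enum andbT; apply/forall_inP => y.
      rewrite inE => yv; apply/forallP => x; apply/implyP => ryx.
      have := wT x; rewrite inE mem_cat => /orP[xu|//].
      by have := ruv x y xu yv; rewrite ryx.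
    apply/allpairsPdep; exists u, v; split=> //.
      rewrite mem_filter [compat r u]cu mem_permutations; apply: uniq_perm => //.
        exact: enum_uniq.
      move=> x; rewrite mem_enum !inE; apply/idP/idP => [xu|xv].
        by apply/negP => /nuv; rewrite xu.
      by have := wT x; rewrite mem_cat (negbTE xv) orbF.
    rewrite mem_filter [compat r v]cv mem_permutations; apply: uniq_perm => //.
      exact: enum_uniq.
    by move=> x; rewrite mem_enum !inE.
  + move=> [A [p [AP /allpairsPdep[u1 [v1 [u1P v1P ->]]] [-> ->]]]].
    exists (u1 ++ v1), (size u1); rewrite take_size_cat ?drop_size_cat //.
    move: AP u1P v1P; rewrite !mem_filter !mem_permutations mem_index_enum andbT.
    move=> /forall_inP upA /andP[cu eu] /andP[cv ev].
    have eT : perm_eq (u1 ++ v1) (enum T).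
      apply: uniq_perm; rewrite ?enum_uniq //.
        rewrite cat_uniq (perm_uniq eu) (perm_uniq ev) !enum_uniq /= andbT.
        apply/hasPn => x; rewrite (perm_mem eu) (perm_mem ev) !mem_enum inE.
        by move=> ->.
      move=> x; rewrite mem_cat (perm_mem eu) (perm_mem ev) !mem_enum !inE.
      by rewrite orNb.
    split=> //.
      rewrite eT andbT /compat pairwise_cat; apply/and3P; split=> //.
      apply/allrelP => x y; rewrite (perm_mem eu) (perm_mem ev) !mem_enum inE.
      move=> xA yA; apply: contra xA => ryx.
      by have /forallP/(_ x) := upA y yA; rewrite ryx.
    rewrite mem_iota add0n ltnS cardE -(perm_size eT) size_cat; exact: leq_addr.
Qed.

End CompatibleWords.

(** * Linear extensions and coproducts *)

Section ThetaMorphism.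
Variable K : fieldType.

Definition std_letters n (w : seq 'I_n) : perms := standardization (map val w).

Lemma std_letters_perm n (s : 'S_n) : std_letters (letters s) = mkperms s.
Proof. by rewrite /std_letters -word_letters std_word. Qed.

Lemma ThetaU (P : sposet) : Theta K << P >> =
  \sum_(w <- permutations (enum 'I_(tag P)) | compat (tagged P) w)
    << std_letters w >>.
Proof.
rewrite [LHS]lextU -(sum_letters _ (fun w => << std_letters w >>)).
apply: eq_big => s; first exact: linear_extensionE.
by rewrite std_letters_perm.
Qed.

Lemma std_letters_map n m (e : 'I_n -> 'I_m) w :
  {mono e : i j / (i <= j)%N} -> uniq w ->
  std_letters (map e w) = std_letters w.
Proof.
move=> mono_e uw; have e_inj : injective e.
  move=> i j eij; apply: val_inj; apply/eqP.
  by rewrite eqn_leq -!mono_e eij leqnn.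
apply: eq_std; rewrite ?map_inj_uniq //; try exact: val_inj.
split=> [|i j]; rewrite !size_map // => iw jw.
have x0 : 'I_n by case: (w) iw.
rewrite !(nth_map (e x0)) ?size_map // !(nth_map x0) //.
by rewrite !ltnNge mono_e.
Qed.

(** The subposet on [A] is carried by ['I_#|A|]; its embedding into [P] is
    increasing, hence standardization does not see it, and its linear extensions
    become the compatible words on the letters in [A]. *)
Lemma Theta_sub (P : sposet) (A : {set 'I_(tag P)}) :
  Theta K << sp_sub P A >> =
  \sum_(w <- permutations (enum A) | compat (tagged P) w) << std_letters w >>.
Proof.
have [e [e_inj e1 e2] eA] := sp_sub_emb A; rewrite ThetaU.
have mono_e : {mono e : i j / (i <= j)%N}.
  by move=> i j; have := e2 i j; rewrite !mk_porderE.
have pe : perm_eq [seq map e w | w <- permutations (enum 'I_(tag (sp_sub P A)))]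
    (permutations (enum A)).
  apply: permutations_map => //; first exact: enum_uniq.
  apply: uniq_perm; rewrite ?(map_inj_uniq e_inj) ?enum_uniq //.
  move=> x; move/setP/(_ x): eA; rewrite mem_enum => <-; apply/mapP/imsetP => -[y _ ->];
  by exists y; rewrite ?inE ?mem_enum.
rewrite -(perm_big _ pe) big_map big_seq_cond [RHS]big_seq_cond.
apply: eq_big => w.
  rewrite /compat pairwise_map; congr (_ && _).
  by apply: eq_pairwise => x y /=; rewrite [in RHS](e1 y x).
rewrite mem_permutations => /andP[/perm_uniq ew _].
by rewrite std_letters_map // ew enum_uniq.
Qed.

Lemma Theta_cop x :
  hcop (FQSym K) (Theta K x) = tmap (Theta K) (Theta K) (hcop (HSP K) x).
Proof.
pose l : {linear {malg K[sposet]} -> _} := hcop (FQSym K) \o Theta K.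
pose r : {linear {malg K[sposet]} -> _} :=
  tmap (Theta K) (Theta K) \o hcop (HSP K).
suff: l =1 r by exact.
apply: linear_malg_ext => P.
apply: (etrans (congr1 (hcop (FQSym K)) (ThetaU P))).
apply: (etrans (linear_sum (hcop (FQSym K)) _ _ _)).
pose G (u v : seq 'I_(tag P)) : {malg K[(perms * perms)%type]} :=
  << (std_letters u, std_letters v) >>.
transitivity (\sum_(w <- permutations (enum 'I_(tag P)) | compat (tagged P) w)
    \sum_(k < #|'I_(tag P)|.+1) G (take k w) (drop k w)).
  rewrite big_seq_cond [RHS]big_seq_cond; apply: eq_bigr => w.
  rewrite mem_permutations => /andP[ew _].
  rewrite hcop_std; last by rewrite (map_inj_uniq val_inj) (perm_uniq ew) enum_uniq.
  rewrite size_map (perm_size ew) -cardE; apply: eq_bigr => k _.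
  by rewrite /G /std_letters !map_take !map_drop.
rewrite sum_cut_compat.
have copE : hcop (HSP K) << P >> =
    \sum_(I : {set 'I_(tag P)} | upper_set (tagged P) I)
       << (sp_sub P (~: I), sp_sub P I) >> by exact: lextU.
apply: (etrans _ (congr1 (tmap (Theta K) (Theta K)) (esym copE))).
rewrite (linear_sum (tmap (Theta K) (Theta K))); apply: eq_bigr => A _.
apply: (etrans _ (esym (tmapU _ _ _ _))).
apply: (etrans _ (esym (f_equal2 (@tens K _ _) (Theta_sub _) (Theta_sub _)))).
apply: (etrans _ (esym (tens_sum _ _ _ _ _ _))).
by apply: eq_bigr => u _; apply: eq_bigr => v _; apply: (esym (tensU _ _ _)).
Qed.

Lemma Theta_one : Theta K (hone (HSP K)) = hone (FQSym K).
Proof.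
rewrite [LHS]lextU (big_pred1 1%g) // => s.
have -> : s = 1%g by apply/permP => -[].
by apply: (etrans _ (esym (eqxx _))); apply/forallP => -[].
Qed.

Lemma Theta_counit x : hcounit (FQSym K) (Theta K x) = hcounit (HSP K) x.
Proof.
pose l : {linear {malg K[sposet]} -> _} := hcounit (FQSym K) \o Theta K.
suff: l =1 hcounit (HSP K) by exact.
apply: linear_malg_ext => P; apply: (etrans _ (esym (lextU _ _))) => /=.
have [->|P1] := eqVneq P sp_one.
  by apply: (etrans (congr1 (hcounit (FQSym K)) Theta_one)); apply: lextU.
have ThetaP : Theta K << P >> = \sum_(s : 'S_(tag P) |
   linear_extension (tagged P) s) << mkperms s >> by exact: lextU.
apply: (etrans (congr1 (hcounit (FQSym K)) ThetaP)).
apply: (etrans (linear_sum (hcounit (FQSym K)) _ _ _)).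
rewrite big1 // => s _; apply: (etrans (lextU _ _)) => /=.
by rewrite sposet_tag0 (negbTE P1).
Qed.

End ThetaMorphism.

(** * Linear extensions and products *)

Section Parts.
Variables T U : eqType.

Definition lpart : seq (T + U) -> seq T :=
  pmap (fun z => if z is inl x then Some x else None).
Definition rpart : seq (T + U) -> seq U :=
  pmap (fun z => if z is inr y then Some y else None).

Lemma mem_lpart x w : (x \in lpart w) = (inl x \in w).
Proof. by elim: w => //= -[y|y] w IHw; rewrite !inE IHw. Qed.

Lemma mem_rpart y w : (y \in rpart w) = (inr y \in w).
Proof. by elim: w => //= -[x|x] w IHw; rewrite !inE IHw. Qed.

Lemma lpart_uniq w : uniq w -> uniq (lpart w).
Proof. by elim: w => //= -[x|y] w IHw /andP[xw /IHw] //=; rewrite mem_lpart xw. Qed.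

Lemma rpart_uniq w : uniq w -> uniq (rpart w).
Proof. by elim: w => //= -[x|y] w IHw /andP[yw /IHw] //=; rewrite mem_rpart yw. Qed.

End Parts.

(** Elements from different sides are incomparable, so each side of the word can
    be tested separately. *)
Lemma compat_sum (T U : finType) (r : rel T) (s : rel U) w :
  compat (sum_rel false r s) w = compat r (lpart w) && compat s (rpart w).
Proof.
rewrite /compat; elim: w => //= -[x|y] w ->.
- rewrite [pairwise _ (x :: lpart w)]/= !andbA; congr (_ && _ && _).
  by elim: w => //= -[z|z] w -> //=.
- rewrite [pairwise _ (y :: rpart w)]/= andbCA; congr (_ && (_ && _)).
  by elim: w => //= -[z|z] w -> //=.
Qed.

Section Shuffles.
Variables n m : nat.

Definition unshift (z : 'I_n + 'I_m) : nat :=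
  match z with inl i => i | inr j => (n + j)%N end.

Lemma filter_unshift_l w :
  [seq k <- map unshift w | (k < n)%N] = map val (lpart w).
Proof.
elim: w => //= -[i|j] w IHw /=; first by rewrite ltn_ord IHw.
by rewrite ltnNge leq_addr /= IHw.
Qed.

Lemma filter_unshift_r w :
  [seq k <- map unshift w | (n <= k)%N] = map (addn n) (map val (rpart w)).
Proof.
elim: w => //= -[i|j] w IHw /=; first by rewrite leqNgt ltn_ord IHw.
by rewrite leq_addr /= IHw.
Qed.

(** The two words have no letter in common and the bound [n] tells their letters
    apart, so the mask of the shuffle is forced. *)
Lemma is_shuffle_filter u v w :
  all (fun k => k < n)%N u -> all (fun k => n <= k)%N v ->
  is_shuffle u v w =
  (u == [seq k <- w | (k < n)%N]) && (v == [seq k <- w | (n <= k)%N]).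
Proof.
move=> uP vP; apply/existsP/andP => [[b /andP[/eqP eu /eqP ev]]|[/eqP eu /eqP ev]].
  move: uP vP; rewrite -{}eu -{}ev.
  case: b => b /= /eqP; elim: b w => [[]//|c b IHb] [//|k w] /= [/IHb {}IHb].
  case: c => /=.
    move=> /andP[kP uP] vP; have [/eqP <- /eqP <-] := IHb uP vP.
    by rewrite kP (leqNgt n k) kP !eqxx.
  move=> uP /andP[kP vP]; have [/eqP <- /eqP <-] := IHb uP vP.
  by rewrite kP ltnNge kP !eqxx.
exists (map_tuple (fun k => k < n)%N (in_tuple w)).
rewrite -map_comp -!filter_mask -eu eqxx /= ev; apply/eqP/eq_filter => k /=.
by rewrite (leqNgt n k).
Qed.

(** The inverse of [letters] on the words listing each element of ['I_p] once;
    the default value is for other words. *)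
Definition perm_of_letters p (w : seq 'I_p) : 'S_p :=
  odflt 1%g [pick s | letters s == w].

Lemma perm_of_lettersK p (w : seq 'I_p) :
  perm_eq w (enum 'I_p) -> letters (perm_of_letters w) = w.
Proof.
rewrite -mem_permutations -(perm_mem (letters_permutations p)).
move=> /mapP[s _ ew]; rewrite /perm_of_letters.
by case: pickP => [t /eqP//|/(_ s)]; rewrite ew eqxx.
Qed.

Definition split_letters (r : 'S_(n + m)) : seq ('I_n + 'I_m) :=
  map (@split n m) (letters r).

Lemma word_split_letters r : word r = map unshift (split_letters r).
Proof.
rewrite word_letters /split_letters -map_comp; apply: eq_map => k /=.
by rewrite -{1}[k]splitK; case: (split k).
Qed.

Lemma mem_split_letters r z : z \in split_letters r.
Proof.
rewrite -[z]unsplitK map_f // (perm_mem (mem_letters r)); exact: mem_enum.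
Qed.

Lemma split_letters_uniq r : uniq (split_letters r).
Proof. by rewrite (map_inj_uniq (can_inj (@splitK n m))) letters_uniq. Qed.

Definition left_perm r : 'S_n := perm_of_letters (lpart (split_letters r)).
Definition right_perm r : 'S_m := perm_of_letters (rpart (split_letters r)).

Lemma left_permE r : letters (left_perm r) = lpart (split_letters r).
Proof.
apply: perm_of_lettersK; apply: uniq_perm; rewrite ?enum_uniq //.
  exact/lpart_uniq/split_letters_uniq.
by move=> i; rewrite mem_lpart mem_split_letters mem_enum.
Qed.

Lemma right_permE r : letters (right_perm r) = rpart (split_letters r).
Proof.
apply: perm_of_lettersK; apply: uniq_perm; rewrite ?enum_uniq //.
  exact/rpart_uniq/split_letters_uniq.
by move=> i; rewrite mem_rpart mem_split_letters mem_enum.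
Qed.

(** Each permutation [r] is a shuffle of exactly one pair of permutations; this
    is why products of sums over linear extensions are multiplicity-free. *)
Lemma is_shuffle_parts (s : 'S_n) (t : 'S_m) (r : 'S_(n + m)) :
  is_shuffle (word s) (map (addn n) (word t)) (word r) =
  (left_perm r == s) && (right_perm r == t).
Proof.
rewrite is_shuffle_filter; last first.
- by rewrite all_map; apply/allP => k _ /=; apply: leq_addr.
- by rewrite word_letters all_map; apply/allP => k _ /=.
rewrite word_split_letters filter_unshift_l filter_unshift_r.
rewrite !word_letters -left_permE -right_permE eq_sym [X in _ && X]eq_sym.
rewrite (inj_eq (inj_map (@addnI n))) !(inj_eq (inj_map val_inj)).
by rewrite !(inj_eq (@letters_inj _)).
Qed.

Variables (P : porder 'I_n) (Q : porder 'I_m).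

(** The first order of the product, carried by ['I_(n + m)] itself instead of the
    set of cardinality [#|'I_n + 'I_m|] on which [sp_mul] places it: the
    permutations in the product of [FQSym] live there. *)
Definition ord_mul : porder 'I_(n + m) :=
  porder_pre (can_inj (@splitK n m)) (porder_sum false P Q).

Lemma linear_extension_mul (r : 'S_(n + m)) : linear_extension ord_mul r =
  linear_extension P (left_perm r) && linear_extension Q (right_perm r).
Proof.
rewrite !linear_extensionE left_permE right_permE -compat_sum.
rewrite /compat [RHS]pairwise_map; apply: eq_pairwise => x y /=.
by rewrite !mk_porderE /= mk_porderE.
Qed.

Lemma sp_mul_ord : sp_mul (Tagged (fun n => porder 'I_n) P)
  (Tagged (fun n => porder 'I_n) Q) = Tagged (fun n => porder 'I_n) ord_mul.
Proof.
apply: sposet_iso_eq; apply: dposet_iso_trans (dposet_iso_sym (sp_mul_iso _ _)) _.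
exists (@unsplit n m); first exact: Bijective (@unsplitK n m) (@splitK n m).
split=> x y; first by rewrite !mk_porderE /= !unsplitK mk_porderE.
rewrite !mk_porderE; case: x y => x [] y /=; rewrite ?mk_porderE //.
- by rewrite ltnW // ltn_addr.
- by rewrite leqNgt ltn_addr.
- exact: leq_add2l.
Qed.

End Shuffles.

Section ThetaProduct.
Variable K : fieldType.

Lemma Theta_perms n (P : porder 'I_n) :
  Theta K << Tagged (fun n => porder 'I_n) P >> =
  \sum_(s : 'S_n | linear_extension P s) << mkperms s >>.
Proof. exact: lextU. Qed.

Lemma Theta_mul x :
  Theta K (hmul (HSP K) x) = hmul (FQSym K) (tmap (Theta K) (Theta K) x).
Proof.
pose l : {linear {malg K[(sposet * sposet)%type]} -> _} :=
  Theta K \o hmul (HSP K).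
pose r : {linear {malg K[(sposet * sposet)%type]} -> _} :=
  hmul (FQSym K) \o tmap (Theta K) (Theta K).
suff: l =1 r by exact.
apply: linear_malg_ext => -[[n P] [m Q]].
have mulE : hmul (HSP K) << (existT _ n P, existT _ m Q) >> =
  << Tagged (fun n => porder 'I_n) (ord_mul P Q) >>.
  by apply: (etrans (lextU _ _)); rewrite /= sp_mul_ord.
apply: (etrans (congr1 (Theta K) mulE)); rewrite Theta_perms.
apply: (etrans _ (congr1 (hmul (FQSym K)) (esym (tmapU _ _ _ _)))).
apply: (etrans _ (congr1 (hmul (FQSym K)) (esym (f_equal2 (@tens K _ _)
   (Theta_perms P) (Theta_perms Q))))).
apply: (etrans _ (congr1 (hmul (FQSym K)) (esym (tens_sum _ _ _ _ _ _)))).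
rewrite pair_big (linear_sum (hmul (FQSym K))).
rewrite (partition_big (fun r => (left_perm r, right_perm r))
  (fun p => linear_extension P p.1 && linear_extension Q p.2)) => [|w]; last first.
  by rewrite linear_extension_mul.
apply: eq_bigr => -[s t] /andP[/= Ps Qt].
apply: (etrans _ (congr1 (hmul (FQSym K)) (esym (tensU _ _ _)))).
apply: (etrans _ (esym (lextU _ _))); apply: eq_bigl => w /=.
rewrite is_shuffle_parts linear_extension_mul xpair_eqE.
by case: eqP => [->|_]; case: eqP => [->|_]; rewrite ?Ps ?Qt ?andbF.
Qed.

Lemma Theta_morphism : hopf_morphism (HSP K) (FQSym K) (Theta K).
Proof.
split; [exact: Theta_mul | exact: Theta_one | exact: Theta_cop |].
exact: Theta_counit.
Qed.

Lemma Theta_HSPP_morphism : hopf_morphism (HSPP K) (FQSym K) (Theta_HSPP K).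
Proof.
have [iM i1 ic ie] := HSPP_incl_morphism K.
have [tM t1 tc te] := Theta_morphism.
split=> [x||x|x].
- by rewrite [LHS]/(Theta K _) iM tM tmap_comp.
- by rewrite -t1 -i1.
- by rewrite [X in hcop _ X]/(Theta K _) tc ic tmap_comp.
- by rewrite [X in hcounit _ X]/(Theta K _) te ie.
Qed.

End ThetaProduct.

(** * Triangularity for the weak order *)

Section PlaneOrders.
Variable n : nat.
Implicit Types (s t : 'S_n) (i j : 'I_n).

Definition position s i : 'I_n := (s^-1)%g i.

Lemma position_inj s : injective (position s).
Proof. exact: perm_inj. Qed.

(** The identification of plane posets with permutations: [sub_rel s] relates
    the pairs that [s] keeps in order and [inv_rel s] its inversions, where
    [position s i] is the place of the letter [i] in the word of [s]. Their union
    is the natural order, and two letters are related by exactly one of them. *)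
Definition sub_rel s : rel 'I_n :=
  fun i j => (i <= j)%N && (position s i <= position s j)%N.

Definition inv_rel s : rel 'I_n :=
  fun i j => (i <= j)%N && (position s j <= position s i)%N.

Fact sub_rel_porder s : is_porder (sub_rel s).
Proof.
apply/is_porderP; split=> [i|i j|j i k]; rewrite /sub_rel ?leqnn //.
  by move=> /andP[/andP[ij _] /andP[ji _]]; apply/val_inj/eqP; rewrite eqn_leq ij.
by move=> /andP[ij sij] /andP[jk sjk]; rewrite (leq_trans ij) // (leq_trans sij).
Qed.

Fact inv_rel_porder s : is_porder (inv_rel s).
Proof.
apply/is_porderP; split=> [i|i j|j i k]; rewrite /inv_rel ?leqnn //.
  by move=> /andP[/andP[ij _] /andP[ji _]]; apply/val_inj/eqP; rewrite eqn_leq ij.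
by move=> /andP[ij sij] /andP[jk sjk]; rewrite (leq_trans ij) // (leq_trans sjk).
Qed.

Definition plane_porder s : porder 'I_n := mk_porder (sub_rel_porder s).

Definition plane_sposet s : sposet := Tagged (fun n => porder 'I_n) (plane_porder s).

Fact plane_sposet_special_plane s : special_plane (dposet_of (plane_sposet s)).
Proof.
apply/special_planeP; exists (mk_porder (inv_rel_porder s)).
  apply/planeP => i j ne; rewrite /comparable_for !mk_porderE.
  have ne' : val i != val j by [].
  have nep : val (position s i) != val (position s j).
    by rewrite (inj_eq val_inj) (inj_eq (@position_inj s)).
  by move: ne' nep; rewrite /sub_rel /inv_rel /=; lia.
by move=> i j; rewrite !mk_porderE /sub_rel /inv_rel -andb_orr leq_total andbT.
Qed.

Definition plane_spposet s : spposet :=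
  exist _ (plane_sposet s) (plane_sposet_special_plane s).

Definition inversions s : {set 'I_n * 'I_n} :=
  [set p : 'I_n * 'I_n | (p.1 < p.2)%N && (position s p.2 < position s p.1)%N].

Lemma linear_extension_self s : linear_extension (plane_porder s) s.
Proof.
apply/forallP => i; apply/forallP => j; apply/implyP => /andP[ne].
rewrite mk_porderE => /andP[_]; rewrite leq_eqVlt (inj_eq val_inj).
by rewrite (inj_eq (@position_inj s)) (negbTE ne).
Qed.

Lemma inversions_inj : injective inversions.
Proof.
move=> s t e; suff : (s^-1 = t^-1)%g by apply: invg_inj.
apply: perm_order_eq => i j.
have [ij|ji|/val_inj ->] := ltngtP (i : nat) j; last by rewrite !ltnn.
- have /setP/(_ (i, j)) := e; rewrite !inE ij /= => eij.
  have ne u : val (position u i) != val (position u j).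
    by rewrite (inj_eq val_inj) (inj_eq (@position_inj u)) -(inj_eq val_inj) ltn_eqF.
  by move: eij (ne s) (ne t); rewrite /position /=; lia.
- by have /setP/(_ (j, i)) := e; rewrite !inE ji.
Qed.

(** A linear extension of [plane_porder s] keeps in order the pairs that [s] keeps
    in order, so its inversions are inversions of [s]: the linear extensions are
    the lower interval of [s] in the weak order. *)
Lemma linear_extension_inversions s t :
  linear_extension (plane_porder s) t -> t != s ->
  (#|inversions t| < #|inversions s|)%N.
Proof.
move=> /forallP le ne; apply: proper_card; rewrite properEneq.
rewrite (inj_eq inversions_inj) ne; apply/subsetP => -[i j].
rewrite !inE /= => /andP[ij tji]; rewrite ij /= ltnNge; apply/negP => sij.
have /forallP/(_ j)/implyP := le i.
rewrite mk_porderE /sub_rel (ltnW ij) sij -(inj_eq val_inj) ltn_eqF // => /(_ isT).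
by rewrite ltnNge ltnW.
Qed.

Lemma total_order_position (r : rel 'I_n) :
  antisymmetric r -> transitive r -> total r ->
  exists s, forall i j, r i j = (position s i <= position s j)%N.
Proof.
move=> ra rt rT; pose w := sort r (enum 'I_n).
exists (perm_of_letters w) => i j; set s := perm_of_letters w.
have lw : letters s = w by apply: perm_of_lettersK; rewrite perm_sort.
have rr : reflexive r by move=> k; have := rT k k; rewrite orbb.
have mono k l : (position s k <= position s l)%N -> r k l.
  move=> le; rewrite -[k](permKV s) -[l](permKV s) -!(nth_letters s k) lw.
  apply: (sorted_leq_nth rt rr) => //; rewrite ?inE -?lw ?size_letters //.
  by rewrite lw; apply: sort_sorted.
apply/idP/idP => [rij|]; last exact: mono.
rewrite leqNgt; apply/negP => lt.
have eij : i = j by apply: ra; rewrite rij mono // ltnW.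
by rewrite eij ltnn in lt.
Qed.

End PlaneOrders.

(** Let [r] be the order complementing the first order [h] of [P]. The natural
    order is the union of [h] and [r]; the union [q] of [h] and of the reverse of
    [r] is also a linear order, and [h] is the intersection of the two. Reading
    the elements in the order [q] gives the permutation. *)
Lemma plane_spposet_surj (P : spposet) :
  exists p : perms, P = plane_spposet (tagged p).
Proof.
case: P => -[n h] sp; have /special_planeP[r /planeP /= pl tot] := sp.
have [h0 h1 h2] := rel_ofP h; have [r0 r1 r2] := rel_ofP r.
have natE (i j : 'I_n) : (i <= j)%N = h i j || r i j.
  by have := tot i j; rewrite mk_porderE.
have excl i j : h i j -> r i j -> i = j.
  move=> hij rij; apply/eqP; apply: contraT => /pl; rewrite /comparable_for /=.
  by rewrite hij rij.
have excl' i j : h i j -> r j i -> i = j.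
  move=> hij rij; apply/eqP; apply: contraT => /pl; rewrite /comparable_for /=.
  by rewrite hij rij orbT.
have dich i j : [\/ h i j, h j i, r i j | r j i].
  have [->|/pl] := eqVneq i j; first by rewrite h0; constructor.
  rewrite /comparable_for /=.
  case: (h i j); case: (h j i); case: (r i j); case: (r j i) => // _;
    by [constructor 1|constructor 2|constructor 3|constructor 4].
pose q : rel 'I_n := fun i j => h i j || r j i.
have [s sE] : exists s : 'S_n, forall i j, q i j = (position s i <= position s j)%N.
  apply: total_order_position.
  - move=> i j /andP[/orP[hij|rji] /orP[hji|rij]].
    + by apply: h1; rewrite hij.
    + exact: excl.
    + exact/esym/excl.
    + by apply: r1; rewrite rij.
  - move=> j i k /orP[hij|rji] /orP[hjk|rkj]; apply/orP.
    + by left; apply: h2 hjk.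
    + have [|hki|rik|] := dich i k; [by left| | |by right].
        have kj : k = j by apply: excl rkj; apply: h2 hij.
        by left; rewrite kj.
      have ij : i = j by apply: excl hij _; apply: r2 rkj.
      by right; rewrite ij.
    + have [|hki|rik|] := dich i k; [by left| | |by right].
        have ji : j = i by apply: excl rji; apply: h2 hki.
        by left; rewrite -ji.
      have jk : j = k by apply: excl hjk _; apply: r2 rik.
      by right; rewrite -jk.
    + by right; apply: r2 rji.
  - by move=> i j; rewrite /q; have [->|->|->|->] := dich i j; rewrite ?orbT.
exists (mkperms s); apply: val_inj => /=; congr Tagged.
apply: porder_ext => i j; rewrite mk_porderE /sub_rel natE -sE /q.
have [//|hij] := boolP (h i j); apply/esym/negbTE; rewrite /=.
apply: contra hij => /andP[rij rji].
by have -> : i = j by apply: r1; rewrite rij.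
Qed.

Section Bijective.
Variable K : fieldType.

Definition lower_terms (p : perms) : {malg K[perms]} :=
  \sum_(t : 'S_(tag p) |
      linear_extension (plane_porder (tagged p)) t && (t != tagged p))
    << mkperms t >>.

(** A permutation is a linear extension of its own plane poset, hence the leading
    coefficient 1; the other linear extensions lie below it in the weak order. *)
Lemma Theta_plane (p : perms) :
  Theta_HSPP K << plane_spposet (tagged p) >> = << p >> + lower_terms p.
Proof.
apply: (etrans (congr1 (Theta K) (HSPP_inclU _ _))).
rewrite Theta_perms (bigD1 (tagged p)) ?linear_extension_self //=.
by case: p.
Qed.

Definition num_inversions (p : perms) : nat := #|inversions (tagged p)|.

Lemma lower_terms_lt p : {in msupp (lower_terms p),
  forall c, (num_inversions c < num_inversions p)%N}.
Proof.
move=> c /msupp_sum_basis[t /andP[le ne] ->].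
exact: linear_extension_inversions.
Qed.

(** Along [phi], which sends a permutation to its plane poset, the map becomes
    the unitriangular endomorphism [U]. Since the plane posets of permutations
    exhaust the basis, [phi] composed with the inverse of [U] is a two-sided
    inverse. *)
Lemma Theta_HSPP_inverse :
  exists2 g : {linear {malg K[perms]} -> {malg K[spposet]}},
    cancel (Theta_HSPP K) g & cancel g (Theta_HSPP K).
Proof.
pose phi : {linear {malg K[perms]} -> {malg K[spposet]}} :=
  lext (fun p => << plane_spposet (tagged p) >>).
pose U : {linear {malg K[perms]} -> {malg K[perms]}} :=
  lext (fun p => << p >> + lower_terms p).
pose V : {linear {malg K[perms]} -> {malg K[perms]}} :=
  lext (unitri_inv num_inversions lower_terms).
have UE : Theta_HSPP K \o phi =1 U.
  have phiU p : phi << p >> = << plane_spposet (tagged p) >> by apply: lextU.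
  apply: (linear_malg_ext (f := Theta_HSPP K \o phi)) => p.
  apply: (etrans (congr1 (Theta_HSPP K) (phiU p))).
  by apply: (etrans (Theta_plane p)); apply/esym/lextU.
have UK : cancel U V by apply: unitriK; exact: lower_terms_lt.
have VK : cancel V U by apply: unitri_invK; exact: lower_terms_lt.
exists (phi \o V) => [x|x].
  pose l : {linear {malg K[spposet]} -> {malg K[spposet]}} :=
    phi \o V \o Theta_HSPP K.
  suff: l =1 idfun by exact.
  apply: linear_malg_ext => P; have [p ->] := plane_spposet_surj P.
  have phiU : phi << p >> = << plane_spposet (tagged p) >> by apply: lextU.
  rewrite -phiU; apply: (etrans (congr1 (phi \o V) (UE << p >>))).
  exact: (congr1 phi (UK << p >>)).
exact: etrans (UE _) (VK x).
Qed.

End Bijective.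

(** * The isomorphism *)

Theorem corollary4p5 (K : fieldType) :
  hopf_isomorphism (HSPP K) (FQSym K) (Theta_HSPP K).
Proof.
have [g fK gK] := Theta_HSPP_inverse K; have Tm := Theta_HSPP_morphism K.
have gm := hopf_morphism_inv fK gK Tm.
have HSPPh : hopf_algebra (HSPP K).
  exact: HSPP_hopf (coalgebra_transport fK gm (FQSym_coalgebra K)).
split=> //; first exact: hopf_transport gK Tm fK HSPPh.
by exists g.
Qed.
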